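(* Almost surely, $$\lim_{n}\ \sup_{t\in[0,1]}\left|\frac{\Upsilon_n(t)}{n}+\mathcal J(1-t)\right|=0.$$
   Context: Let $(b_{i,j})_{i,j\ge1}$ be a doubly infinite array of i.i.d. $\mathcal N(0,1)$ random variables on one probability space. For $1\le r\le n$ set $\widetilde b_{i,j}=b_{i,j}/(\sum_{k=1}^n b_{k,j}^2)^{1/2}$ (the dependence on $n$ is omitted) and let $\widetilde B_{n,r}=(\widetilde b_{i,j})_{1\le i\le n,\,1\le j\le r}$, an $n\times r$ matrix whose columns are independent and uniformly distributed on the unit sphere of $\mathbb{R}^n$. Let $\Upsilon_{n,r}=\log\det(\widetilde B_{n,r}'\widetilde B_{n,r})$, where $'$ denotes transpose, with $\Upsilon_{n,0}=0$, and $\Upsilon_n(t)=\Upsilon_{n,\lfloor nt\rfloor}$ for $t\in[0,1]$. The function $\mathcal J$ is $\mathcal J(u)=u\log u-u+1$ for $u>0$, $\mathcal J(0)=1$, $\mathcal J(u)=+\infty$ for $u<0$. *)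

(* Defs.v *)
From HB Require Import structures.
From mathcomp Require Import all_boot all_order all_algebra.
From mathcomp Require Import all_classical all_reals all_analysis.

Set Implicit Arguments.
Unset Strict Implicit.
Unset Printing Implicit Defensive.

Import Order.TTheory GRing.Theory Num.Theory.
Import numFieldNormedType.Exports.

Local Open Scope classical_set_scope.
Local Open Scope ring_scope.

Section independence.
Context d (T : measurableType d) (R : realType) (P : probability T R).

Definition mutually_independent (I : choiceType) (X : I -> {RV P >-> R}) :=
  forall (J : seq I) (A : I -> set R), uniq J ->
    (forall i, i \in J -> measurable (A i)) ->
    P (\bigcap_(i in [set` J]) X i @^-1` A i) =
    (\prod_(i <- J) P (X i @^-1` A i))%E.

(* [normal_prob m s] has mean m and standard deviation s.  The laws are compared
   on measurable sets only: elsewhere [P] is unconstrained. *)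
Definition iid_standard_normal (I : choiceType) (X : I -> {RV P >-> R}) :=
  mutually_independent X /\
  forall i (A : set R), measurable A ->
    distribution P (X i) A = normal_prob (0 : R) 1 A.

End independence.

Section log_determinant.
Context (R : realType).

(* One realization of the array.  Indices start at 0: the entry written
   b_{i,j} with i, j >= 1 is [b i.-1 j.-1]. *)
Variable b : nat -> nat -> R.

Definition normalized_mx (n r : nat) : 'M[R]_(n, r) :=
  \matrix_(i < n, j < r) (b i j / Num.sqrt (\sum_(k < n) b k j ^+ 2)).

(* [lne] is the extended logarithm, so that log 0 = -oo.  For r = 0 the
   determinant of the empty matrix is 1, which gives Upsilon_{n,0} = 0. *)
Definition Upsilon (n r : nat) : \bar R :=
  lne (\det ((normalized_mx n r)^T *m normalized_mx n r))%:E.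

(* [Num.truncn] is the floor function on nonnegative reals. *)
Definition Upsilon_proc (n : nat) (t : R) : \bar R :=
  Upsilon n (Num.truncn (n%:R * t)).

Lemma Upsilon_n0 n : Upsilon n 0 = 0%E.
Proof. by rewrite /Upsilon det_mx00 lne_EFin// ln1. Qed.

Definition calJ (u : R) : \bar R :=
  if 0 < u then (u * ln u - u + 1)%:E
  else if u == 0 then 1%E else +oo%E.

End log_determinant.

(* Main.v *)
Require Import Defs.
From HB Require Import structures.
From mathcomp Require Import all_boot all_order all_algebra.
From mathcomp Require Import all_classical all_reals all_analysis.
From mathcomp Require Import measurable_realfun ring lra zify.
Import Order.TTheory GRing.Theory Num.Theory.
Import numFieldNormedType.Exports.
Local Open Scope classical_set_scope.
Local Open Scope ring_scope.
Set Implicit Arguments.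
Unset Strict Implicit.
Unset Printing Implicit Defensive.

(** The Gram determinant [D_r] of the first [r] columns of an [n]-row Gaussian
array is the product of the squared distances from each column to the span of
the preceding ones, and [Upsilon n r] is [ln D_r - ln N_r] when these are
positive, where [N_r] is the product of the squared norms of these columns.
Both [D_r] and [N_r] turn out to be within a power of [n] of an explicit
number, uniformly in [r], and Stirling's formula turns this into the limit.

Given the first [r] columns, column [r] (counting from 0) is independent of
them ([integral_splice]), and its squared distance to their span is
[x^T Q x], with [Q] a projection of rank [n - r] ([det_gram_row_mx]). The
Laplace transform of a Gaussian quadratic form ([gauss_laplace]) is computed by
integrating the coordinates one at a time, completing the square each time; on
the matrix side this replaces a positive definite matrix by its Schur
complement. It yields all that is needed about column [r], given the preceding
ones: the mean of [D_(r+1)] is at most [(n - r) * D_r], the mean of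
[1 / D_(r+1)] is at most [1 / ((n - r - 2) * D_r)] when [n - r > 2], and, if
[D_r > 0] and [r < n], the probability of [D_(r+1) <= eta * D_r] is at most
[e * sqrt eta]. By induction on [r], [D_r] has mean at most the falling
factorial [n ^_ r], and [1 / D_r] has mean at most [1 / (n - 2) ^_ r] for
[r <= n - 2]; the case of no preceding column gives the same for [N_r], with
[n ^ r] and [(n - 2) ^ r].

Markov's inequality with a factor [n ^ 4], and the small-ball bound for the
last two columns, which have no inverse moment, show that with probability
[1 - O(n ^ -2)] the array is [typical]: [ln D_r] and [ln N_r] are within
[O(ln n)] of [ln (n ^_ r)] and [r * ln n], for all [r <= n] at once. By
Borel-Cantelli almost every array is typical for all large [n]
([ae_eventually_typical]). As [ln (n ^_ r) - r * ln n] is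
[- n * J (1 - r / n)] up to [O(ln n)], and [J] has a square-root modulus of
continuity on [0, 1], the supremum over [t] is at most [55 / sqrt n]
([Upsilon_proc_typical]). *)

(** * Independence and decoupling *)

Section independence_theory.
Context d (T : measurableType d) (R : realType) (P : probability T R).
Local Open Scope ereal_scope.

(** Independence from a fixed event extends from a pi-system to the
sigma-algebra that it generates. *)
Lemma indep_g_sigma_algebra (G : set (set T)) (B : set T) :
  setI_closed G -> G `<=` measurable -> measurable B ->
  (forall A, G A -> P (A `&` B) = P A * P B) ->
  forall A, <<s G >> A -> P (A `&` B) = P A * P B.
Proof.
move=> GI Gm mB GB A sA.
suff: <<s G >> `<=` [set A | measurable A /\ P (A `&` B) = P A * P B].
  by move=> /(_ _ sA)[].
apply: lambda_system_subset => //; last first.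
  by move=> C GC; split; [exact: Gm|exact: GB].
apply/dynkin_lambda_system; split => //=.
- by split => //; rewrite setTI probability_setT mul1e.
- move=> C [mC PC]; split; first exact: measurableC.
  rewrite setIC -setDE measureD//; last by rewrite ltey_eq fin_num_measure.
  rewrite (setIC B C) [X in _ - X]PC probability_setC// muleBl ?mul1e// ?fin_num_measure//.
- move=> F tF mF; split; first by apply: bigcup_measurable => k _; case: (mF k).
  have m1 k : setT k -> measurable (F k) by case: (mF k).
  have m2 k : setT k -> measurable (F k `&` B) by move=> /m1 ?; exact: measurableI.
  rewrite setI_bigcupl (measure_bigcup _ _ _ m1)// (measure_bigcup _ _ _ m2)//; last first.
    exact: trivIset_setIr.
  have [b Pb] : exists b : R, P B = b%:E.
    by exists (fine (P B)); rewrite fineK// fin_num_measure.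
  rewrite Pb muleC -nneseriesZl//; apply: eq_eseriesr => k _.
  by rewrite muleC -Pb; case: (mF k).
Qed.

Context (I : choiceType) (X : I -> {RV P >-> R}).

(** The events specified by finitely many of the variables [X i] with [p i];
they form a pi-system that generates the sigma-algebra of these variables. *)
Definition cylinder (p : pred I) : set (set T) := [set C |
  exists (J : seq I) (A : I -> set R), [/\ uniq J, all p J,
    forall i, measurable (A i) & C = \bigcap_(i in [set` J]) X i @^-1` A i]].

Lemma cylinder_measurable p : cylinder p `<=` measurable.
Proof.
move=> _ [J [A [_ _ mA ->]]].
rewrite bigcap_seq; apply: bigsetI_measurable => i _.
by rewrite -[X in measurable X]setTI; exact: measurable_funPT.
Qed.

Lemma cylinder_setI p : setI_closed (cylinder p).
Proof.
move=> _ _ [J [A [uJ pJ mA ->]]] [K [B [uK pK mB ->]]].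
pose C i := (if i \in J then A i else setT) `&` (if i \in K then B i else setT).
exists (undup (J ++ K)), C; split.
- exact: undup_uniq.
- by apply/allP => i; rewrite mem_undup mem_cat => /orP[]; apply/allP.
- by move=> i; apply: measurableI; case: ifP.
- apply/seteqP; split => w /=.
    move=> [JA KB] i /=; rewrite mem_undup mem_cat => _.
    by split; case: ifP => //; [exact: JA|exact: KB].
  move=> H; split => i /= iJ; have := H i.
    by rewrite /= mem_undup mem_cat iJ /C iJ => /(_ isT)[].
  by rewrite /= mem_undup mem_cat iJ orbT /C iJ => /(_ isT)[].
Qed.

Hypothesis indepX : mutually_independent X.

(** Disjoint subfamilies of an independent family generate independent
sigma-algebras. *)
Lemma indep_cylinder (p q : pred I) : (forall i, p i -> ~~ q i) ->
  forall A B, <<s cylinder p >> A -> <<s cylinder q >> B ->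
  P (A `&` B) = P A * P B.
Proof.
move=> pq A B sA sB.
apply: (indep_g_sigma_algebra (@cylinder_setI p) (@cylinder_measurable p)) => //.
  by apply: smallest_sub sB; [exact: sigma_algebra_measurable|exact: cylinder_measurable].
move=> {sA} {}A cA; rewrite setIC muleC.
apply: (indep_g_sigma_algebra (@cylinder_setI q) (@cylinder_measurable q)) => //.
  exact: cylinder_measurable cA.
move=> {sB} {}B [K [B' [uK qK mB ->]]]; case: cA => J [A' [uJ pJ mA ->]].
pose C i := if i \in J then A' i else B' i.
have JK i : i \in J -> i \notin K.
  by move=> /(allP pJ)/pq; apply: contra => /(allP qK).
have KC : \bigcap_(i in [set` K]) X i @^-1` B' i =
          \bigcap_(i in [set` K]) X i @^-1` C i.
  apply: eq_bigcapr => i /= iK; rewrite /C ifN//.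
  by apply/negP => /JK; rewrite iK.
have JC : \bigcap_(i in [set` J]) X i @^-1` A' i =
          \bigcap_(i in [set` J]) X i @^-1` C i.
  by apply: eq_bigcapr => i /= iJ; rewrite /C iJ.
have mC i : measurable (C i) by rewrite /C; case: ifP.
rewrite KC JC -bigcap_setU.
have -> : [set` K] `|` [set` J] = [set` K ++ J].
  apply/seteqP; split => i /=; rewrite mem_cat.
    by move=> [] ->; rewrite ?orbT.
  by move=> /orP[]; [left|right].
rewrite !indepX ?big_cat//.
rewrite cat_uniq uK uJ andbT/=; apply/hasPn => i iJ; exact: JK.
Qed.

End independence_theory.

(** Measurability of a function of an array of reals, without a sigma-algebra on
arrays: the composite with any family of measurable entries is measurable. *)
Definition array_measurable (I : Type) (R : realType) (F : (I -> R) -> \bar R) :=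
  forall d (S : measurableType d) (c : S -> I -> R),
    (forall i, measurable_fun setT (fun s => c s i)) ->
    measurable_fun setT (fun s => F (c s)).

(** The array equal to [a] where [p] holds and to [x] elsewhere. *)
Definition splice (I S : Type) (p : pred I) (a x : I -> S) : I -> S :=
  fun i => if p i then a i else x i.

Section decoupling.
Context d (T : measurableType d) (R : realType) (P : probability T R).
Context (I : choiceType) (X : I -> {RV P >-> R}).
Hypothesis indepX : mutually_independent X.
Local Open Scope ereal_scope.

(** Decoupling: the variables outside [p] may be replaced by an independent
copy, here the same variables at a second sample point. *)
Lemma integral_splice (p : pred I) (F : (I -> R) -> \bar R) :
  array_measurable F -> (forall a, 0 <= F a) ->
  \int[P]_w F (fun i => X i w) =
  \int[P]_w \int[P]_w' F (splice p (fun i => X i w) (fun i => X i w')).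
Proof.
move=> mF F0.
(* On [T1] and [T2] only the variables in [p], resp. outside [p], are measurable;
by independence, the diagonal carries [P] to the product measure. *)
set T1 := g_sigma_algebraType (cylinder X p).
set T2 := g_sigma_algebraType (cylinder X (predC p)).
have sub1 q (A : set T) : <<s cylinder X q >> A -> measurable A.
  by apply: smallest_sub; [exact: sigma_algebra_measurable|exact: cylinder_measurable].
have mid q : measurable_fun setT (id : T -> g_sigma_algebraType (cylinder X q)).
  by move=> _ A mA; rewrite setTI; exact: sub1 mA.
have mX (q : pred I) i : q i -> measurable_fun setT (X i : g_sigma_algebraType (cylinder X q) -> R).
  move=> qi _ A mA; rewrite setTI; apply: sub_sigma_algebra.
  exists [:: i], (fun=> A); split => //=; first by rewrite qi.
  by apply/seteqP; split => w /=; [move=> Aw j /=; rewrite inE => /eqP ->|apply; rewrite /= inE].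
pose idT1 : {mfun T >-> T1} := HB.pack (id : T -> T1)
  (isMeasurableFun.Build _ _ _ _ _ (mid p)).
pose idT2 : {mfun T >-> T2} := HB.pack (id : T -> T2)
  (isMeasurableFun.Build _ _ _ _ _ (mid (predC p))).
pose diag : T -> T1 * T2 := fun w => (w, w).
have mdiag : measurable_fun setT diag by exact/measurable_fun_pair.
pose diagm : {mfun T >-> (T1 * T2)%type} := HB.pack diag
  (isMeasurableFun.Build _ _ _ _ _ mdiag).
pose P1 : probability T1 R := distribution P idT1.
pose P2 : probability T2 R := distribution P idT2.
pose P12 : probability (T1 * T2)%type R := distribution P diagm.
have P12E C : measurable C -> (P1 \x P2) C = P12 C.
  apply: product_measure_unique => A B mA mB /=.
  have := indep_cylinder indepX (p := p) (q := predC p) _ mA mB.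
  by rewrite /distribution /pushforward/=; apply => i pi; rewrite /= negbK.
pose f (z : T1 * T2) := F (splice p (fun i => X i z.1) (fun i => X i z.2)).
have mf : measurable_fun setT f.
  apply: mF => i; rewrite /splice; case: (boolP (p i)) => pi.
    by apply: measurableT_comp (mX p i pi) _.
  by apply: measurableT_comp (mX (predC p) i pi) _.
have f0 z : 0 <= f z by exact: F0.
transitivity (\int[P12]_z f z).
  rewrite ge0_integral_distribution//; apply: eq_integral => w _ /=.
  by rewrite /f/=; congr F; apply/funext => i; rewrite /splice; case: ifP.
transitivity (\int[P1 \x P2]_z f z).
  by apply: eq_measure_integral => C mC _; exact: esym (P12E C mC).
rewrite fubini_tonelli1// ge0_integral_distribution//; last 2 first.
- exact: measurable_fun_fubini_tonelli_F.
- by move=> w; apply: integral_ge0.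
apply: eq_integral => w _ /=; rewrite /fubini_F ge0_integral_distribution//.
exact: measurableT_comp.
Qed.
End decoupling.

(** * Gaussian integrals in one variable *)

Section density.
Local Open Scope ereal_scope.
Context d (T : measurableType d) (R : realType).
Variables (mu nu : {measure set T -> \bar R}) (p : T -> R).
Hypotheses (mp : measurable_fun setT p) (p0 : forall x, (0 <= p x)%R).
Hypothesis nuE : forall A, measurable A -> nu A = \int[mu]_(x in A) (p x)%:E.

Import HBNNSimple.

Lemma ge0_integral_density (f : T -> \bar R) :
  measurable_fun setT f -> (forall x, 0 <= f x) ->
  \int[nu]_x f x = \int[mu]_x (f x * (p x)%:E).
Proof.
move=> mf f0.
pose h := nnsfun_approx measurableT mf.
have hf x : (h n x)%:E @[n --> \oo] --> f x by exact: cvg_nnsfun_approx.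
have h_nd x : {homo (fun n => h n x) : a b / (a <= b)%N >-> (a <= b)%R}.
  by move=> a b ab; exact/lefP/nd_nnsfun_approx.
have mpE : measurable_fun setT (EFin \o p) by exact/measurable_EFinP.
transitivity (limn (fun n => \int[nu]_x (h n x)%:E)).
  rewrite -monotone_convergence//.
  - by apply: eq_integral => x _; apply/esym/cvg_lim => //; exact: hf.
  - by move=> n; exact/measurable_EFinP.
  - by move=> n x _; rewrite lee_fin.
  - by move=> x _ a b ab; rewrite lee_fin h_nd.
transitivity (limn (fun n => \int[mu]_x ((h n x)%:E * (p x)%:E))); last first.
  rewrite -monotone_convergence//.
  - apply: eq_integral => x _; apply/cvg_lim => //.
    by apply: cvgeZr => //; exact: hf.
  - by move=> n; apply: emeasurable_funM => //; exact/measurable_EFinP.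
  - by move=> n x _; rewrite mule_ge0// lee_fin.
  - by move=> x _ a b ab; rewrite lee_wpmul2r// ?lee_fin// h_nd.
congr (limn _); apply/funext => n.
have mh r : measurable (h n @^-1` [set r]) by exact: measurable_sfunP.
under [RHS]eq_integral => x _.
  rewrite fimfunE -fsumEFin// ge0_mule_fsuml; last first.
    by move=> y; exact: nnfun_muleindic_ge0.
  over.
rewrite integralT_nnsfun sintegralE ge0_integral_fsum//; last 2 first.
- move=> r; apply: emeasurable_funM => //.
  by apply/measurable_EFinP; exact: measurable_funM.
- move=> r x _; apply: mule_ge0; last by rewrite lee_fin.
  exact: nnfun_muleindic_ge0.
apply: eq_fsbigr => r /[!inE] -[x0 _ <-].
under eq_integral do rewrite EFinM -muleA.
rewrite ge0_integralZl//; last 3 first.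
- by apply: emeasurable_funM => //; exact/measurable_EFinP.
- by move=> x _; rewrite mule_ge0// lee_fin.
- by rewrite lee_fin.
congr (_ * _); rewrite nuE// integral_mkcond; apply: eq_integral => x _.
by rewrite epatch_indic muleC.
Qed.

End density.

Section reindex.
Context d (T : measurableType d) (R : realType) (P : probability T R).

Lemma mutually_independent_comp (I J : choiceType) (X : I -> {RV P >-> R})
    (phi : J -> I) : injective phi ->
  mutually_independent X -> mutually_independent (X \o phi).
Proof.
move=> phi_inj iX K A uK mA.
(* The set [A j], carried over to the index [phi j]. *)
pose B i := nth setT (map A K) (index i (map phi K)).
have BE j : j \in K -> B (phi j) = A j.
  by move=> jK; rewrite /B index_map// (nth_map j) ?index_mem// nth_index.
have := iX (map phi K) B; rewrite map_inj_uniq// => /(_ uK).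
have mB i : i \in map phi K -> measurable (B i).
  by move=> /mapP[j jK ->]; rewrite BE//; exact: mA.
move=> /(_ mB); rewrite big_map => H.
transitivity (P (\bigcap_(i in [set` map phi K]) X i @^-1` B i)).
  congr (P _); apply/seteqP; split => w /= H1.
    by move=> _ /= /mapP[j jK ->]; rewrite BE//; exact: H1.
  by move=> j /= jK; rewrite -BE//; apply: H1 => /=; exact: map_f.
rewrite H !big_seq; apply: eq_bigr => j jK /=; by rewrite BE.
Qed.

Lemma iid_standard_normal_comp (I J : choiceType) (X : I -> {RV P >-> R})
    (phi : J -> I) : injective phi ->
  iid_standard_normal X -> iid_standard_normal (X \o phi).
Proof.
move=> phi_inj [iX nX]; split; first exact: mutually_independent_comp.
by move=> j; exact: nX.
Qed.

Local Open Scope ereal_scope.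

Lemma integral_standard_normal (X : {RV P >-> R}) (f : R -> \bar R) :
  (forall A, measurable A -> distribution P X A = normal_prob (0%R : R) 1%R A) ->
  measurable_fun setT f -> (forall x, 0 <= f x) ->
  \int[P]_w f (X w) =
  \int[lebesgue_measure]_x (f x * (normal_pdf 0%R 1%R x)%:E).
Proof.
move=> XN mf f0.
(* The Lebesgue measure lives on [measurableTypeR R], which has the same
measurable sets as [R] but another display. *)
have mX : measurable_fun setT (X : T -> measurableTypeR R).
  by move=> _ A mA; exact: (@measurable_funPT _ _ _ _ X).
pose X' : {mfun T >-> measurableTypeR R} := HB.pack (X : T -> measurableTypeR R)
  (isMeasurableFun.Build _ _ _ _ _ mX).
rewrite -[LHS]/(\int[P]_w (f \o X') w) -(ge0_integral_distribution X')//.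
apply: (ge0_integral_density (mu := lebesgue_measure) (nu := distribution P X')
  (p := normal_pdf 0%R 1%R)) => //; first exact: measurable_normal_pdf.
by move=> x; exact: normal_pdf_ge0.
Qed.

Lemma integral_gaussian_exp_quad (X : {RV P >-> R}) (s c : R) :
  (forall A, measurable A -> distribution P X A = normal_prob (0%R : R) 1%R A) ->
  (0 < s)%R ->
  \int[P]_w (expR (- ((s - 1) * X w ^+ 2 + c * X w *+ 2) / 2))%:E =
  ((Num.sqrt s)^-1 * expR (c ^+ 2 / s / 2))%:E.
Proof.
move=> XN s0.
pose f (x : R) := (expR (- ((s - 1) * x ^+ 2 + c * x *+ 2) / 2))%:E.
rewrite -[LHS]/(\int[P]_w f (X w)).
rewrite integral_standard_normal//; first last.
- by move=> x; rewrite lee_fin expR_ge0.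
- apply/measurable_EFinP; apply: measurableT_comp => //.
  apply: measurable_funM => //; apply: measurableT_comp => //.
  apply: measurable_funD; first by apply: measurable_funM => //; exact: measurable_funX.
  by rewrite [X in measurable_fun _ X](_ : _ = (fun x => (c *+ 2) * x)%R); [exact: measurable_funM|apply/funext => x; rewrite mulrnAl].
(* Completing the square turns the integrand into a multiple of the density of
the normal law of mean [- c / s] and variance [1 / s]. *)
pose sg : R := ((Num.sqrt s)^-1)%R.
have sg0 : (0 < sg)%R by rewrite invr_gt0 sqrtr_gt0.
pose K := ((Num.sqrt s)^-1 * expR (c ^+ 2 / s / 2))%R.
transitivity (\int[lebesgue_measure]_x (K%:E * (normal_pdf (- c / s)%R sg x)%:E)).
  apply: eq_integral => x _; rewrite /f -!EFinM; congr (_%:E).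
  rewrite !normal_pdfE ?oner_eq0 ?gt_eqF//.
  rewrite /normal_peak /normal_fun.
  set q := (1 ^+ 2 * pi *+ 2)%R.
  have sg2 : (sg ^+ 2 = s^-1)%R by rewrite exprVn sqr_sqrtr// ltW.
  have -> : (Num.sqrt (sg ^+ 2 * pi *+ 2) = sg * Num.sqrt q)%R.
    have -> : (sg ^+ 2 * pi *+ 2 = s^-1 * q)%R by rewrite sg2 /q expr1n mul1r -mulrnAr.
    by rewrite sqrtrM ?invr_ge0 ?(ltW s0)// sqrtrV// ltW.
  rewrite invfM /K -/sg sg2.
  have -> e1 e2 y : (sg * e1 * (sg^-1 * y * e2) = y * (e1 * e2))%R.
    by field; rewrite gt_eqF.
  rewrite mulrCA -!expRD; congr (_ * expR _)%R.
  by field; rewrite gt_eqF.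
rewrite ge0_integralZl//; last 3 first.
- by apply/measurable_EFinP; exact: measurable_normal_pdf.
- by move=> x _; rewrite lee_fin normal_pdf_ge0.
- by rewrite lee_fin mulr_ge0 ?expR_ge0// ltW.
by rewrite integral_normal_pdf mule1.
Qed.

End reindex.

(** * Schur complements, quadratic forms and Gram determinants *)

Section schur.
Context (R : fieldType).

Lemma det_schur_ul m n (A : 'M[R]_m) (B : 'M[R]_(m, n)) (C : 'M[R]_(n, m)) (D : 'M[R]_n) :
  A \in unitmx ->
  \det (block_mx A B C D) = (\det A) * \det (D - C *m invmx A *m B).
Proof.
move=> uA.
have E : block_mx A B C D *m block_mx 1%:M (- (invmx A *m B)) 0 1%:M =
         block_mx A 0 C (D - C *m invmx A *m B).
  rewrite mulmx_block !mulmx1 !mulmx0 !mulmxN !addr0 mulmxA mulmxV// mul1mx.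
  by rewrite addNr mulmxA [in RHS]addrC.
have := congr1 (fun M => \det M) E.
by rewrite det_mulmx det_ublock !det1 !mulr1 det_lblock => ->.
Qed.

Lemma det_schur_dr m n (A : 'M[R]_m) (B : 'M[R]_(m, n)) (C : 'M[R]_(n, m)) (D : 'M[R]_n) :
  D \in unitmx ->
  \det (block_mx A B C D) = (\det D) * \det (A - B *m invmx D *m C).
Proof.
move=> uD.
have E : block_mx A B C D *m block_mx 1%:M 0 (- (invmx D *m C)) 1%:M =
         block_mx (A - B *m invmx D *m C) B 0 D.
  rewrite mulmx_block !mulmx1 !mulmx0 !mulmxN !add0r mulmxA.
  by rewrite [D *m (_ *m _)]mulmxA mulmxV// mul1mx subrr.
have := congr1 (fun M => \det M) E.
by rewrite det_mulmx det_lblock !det1 !mulr1 det_ublock mulrC => ->.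
Qed.

End schur.

Section quadratic_forms.
Context (R : realFieldType).

(** The value at [x] of the quadratic form with matrix [S]. *)
Definition qform n (S : 'M[R]_n) (x : 'cV[R]_n) : R := (x^T *m S *m x) 0 0.

(** Symmetric and positive definite. *)
Definition posdef n (S : 'M[R]_n) :=
  S^T = S /\ forall x, x != 0 -> 0 < qform S x.

Lemma qformD n (S S' : 'M[R]_n) x : qform (S + S') x = qform S x + qform S' x.
Proof. by rewrite /qform mulmxDr mulmxDl mxE. Qed.

Lemma qformN n (S : 'M[R]_n) x : qform (- S) x = - qform S x.
Proof. by rewrite /qform mulmxN mulNmx mxE. Qed.

Lemma qformZ n c (S : 'M[R]_n) x : qform (c *: S) x = c * qform S x.
Proof. by rewrite /qform -scalemxAr -scalemxAl mxE. Qed.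

Lemma qform1 n (x : 'cV[R]_n) : qform 1%:M x = \sum_i x i 0 ^+ 2.
Proof. by rewrite /qform mulmx1 mxE; apply: eq_bigr => i _; rewrite mxE. Qed.

Lemma qform1_ge0 n (x : 'cV[R]_n) : 0 <= qform 1%:M x.
Proof. by rewrite qform1; apply: sumr_ge0 => i _; exact: sqr_ge0. Qed.

Lemma qform1_gt0 n (x : 'cV[R]_n) : x != 0 -> 0 < qform 1%:M x.
Proof.
move=> x0; rewrite lt_def qform1_ge0 andbT; apply: contra x0.
rewrite qform1 psumr_eq0 => [/allP H|i _]; last exact: sqr_ge0.
apply/eqP/colP => i; rewrite mxE; apply/eqP.
by have := H i; rewrite mem_index_enum sqrf_eq0; apply.
Qed.

Lemma qform_outer n (u y : 'cV[R]_n) :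
  qform (u *m u^T) y = (u^T *m y) 0 0 ^+ 2.
Proof.
rewrite /qform mulmxA -[_ *m u^T *m y]mulmxA mxE big_ord1 expr2; congr (_ * _).
by rewrite -[y^T *m u]trmxK mxE trmx_mul trmxK.
Qed.

Lemma qform_idem n (S : 'M[R]_n) x : S^T = S -> S *m S = S ->
  qform S x = qform 1%:M (S *m x).
Proof. by move=> tS SS; rewrite /qform mulmx1 trmx_mul tS mulmxA -[_ *m S *m S]mulmxA SS. Qed.

(** Splitting off the first coordinate. *)
Lemma qform_col_mx n (S : 'M[R]_(1 + n)) (t : R) (y : 'cV[R]_n) : S^T = S ->
  qform S (col_mx t%:M y) =
  ulsubmx S 0 0 * t ^+ 2 + ((dlsubmx S)^T *m y) 0 0 * t *+ 2 + qform (drsubmx S) y.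
Proof.
move=> Ssym; have Eur : ursubmx S = (dlsubmx S)^T by rewrite trmx_dlsub Ssym.
rewrite /qform tr_col_mx -{1}[S]submxK mul_row_block mul_row_col.
rewrite tr_scalar_mx !mulmxDl mul_scalar_mx mul_scalar_mx !mul_mx_scalar Eur.
have -> : (y^T *m dlsubmx S) = ((dlsubmx S)^T *m y).
  apply/matrixP => i j; rewrite !ord1.
  by rewrite -[y^T *m _]trmxK mxE trmx_mul trmxK.
rewrite -!scalemxAl !mxE.
by ring.
Qed.

Lemma posdef_ul n (S : 'M[R]_(1 + n)) : posdef S -> 0 < ulsubmx S 0 0.
Proof.
move=> [Ssym Spos]; have := Spos (col_mx 1%:M 0).
rewrite qform_col_mx// expr1n mulr1 mulmx0 /qform trmx0 mulmx0 !mxE mul0r mul0rn !addr0.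
apply; apply/eqP => /colP /(_ (lshift _ 0)); rewrite col_mxEu !mxE eqxx => /eqP.
by rewrite oner_eq0.
Qed.

(** The Schur complement of the upper left entry: the form left on the last [n]
coordinates once the first one is eliminated by completing the square. *)
Definition schur_compl n (S : 'M[R]_(1 + n)) : 'M[R]_n :=
  drsubmx S - (ulsubmx S 0 0)^-1 *: (dlsubmx S *m (dlsubmx S)^T).

Lemma posdef_schur_compl n (S : 'M[R]_(1 + n)) : posdef S -> posdef (schur_compl S).
Proof.
move=> pS; have a0 := posdef_ul pS; case: pS => Ssym Spos.
split.
  rewrite /schur_compl linearB linearZ/= trmx_mul trmxK trmx_drsub Ssym.
  by [].
move=> y y0; set a := ulsubmx S 0 0 in a0 *.
set u := dlsubmx S; set c := (u^T *m y) 0 0.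
(* [- c / a] minimizes the form in its first coordinate. *)
have := Spos (col_mx (- c / a)%:M y); rewrite qform_col_mx//.
rewrite /schur_compl qformD qformN qformZ qform_outer -/u -/a -/c.
have -> : a * (- c / a) ^+ 2 + c * (- c / a) *+ 2 = - (a^-1 * c ^+ 2).
  by field; rewrite gt_eqF.
rewrite addrC; apply; apply: contra y0 => /eqP H.
by rewrite -[y](@col_mxKd _ 1 n 1 (- c / a)%:M) H linear0.
Qed.

Lemma det_schur_compl n (S : 'M[R]_(1 + n)) : posdef S ->
  \det S = ulsubmx S 0 0 * \det (schur_compl S).
Proof.
move=> pS; have a0 := posdef_ul pS; case: pS => Ssym _.
have E : ulsubmx S = (ulsubmx S 0 0)%:M by rewrite [LHS]mx11_scalar.
have uE : ulsubmx S \in unitmx.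
  by rewrite unitmxE E det_scalar1 unitfE gt_eqF.
rewrite -{1}[S]submxK det_schur_ul// {1}E det_scalar1; congr (_ * \det _).
have Eur : ursubmx S = (dlsubmx S)^T by rewrite trmx_dlsub Ssym.
by rewrite /schur_compl {1}E invmx_scalar mul_mx_scalar -scalemxAl Eur.
Qed.

End quadratic_forms.

Section gram.
Context (R : realFieldType) (n r : nat) (A : 'M[R]_(n, r)).
Let G := A^T *m A.

(** The orthogonal projection onto the orthogonal complement of the column
space of [A], when the columns of [A] are free. *)
Definition coproj : 'M[R]_n := 1%:M - A *m invmx (A^T *m A) *m A^T.

(** Adding the column [x] multiplies the Gram determinant by the squared
distance from [x] to the column space of [A]. *)
Lemma det_gram_row_mx (x : 'cV[R]_n) : G \in unitmx ->
  \det ((row_mx A x)^T *m row_mx A x) = \det G * qform coproj x.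
Proof.
move=> uG; rewrite tr_row_mx mul_col_row det_schur_ul//; congr (_ * _).
rewrite det_mx11 /qform /coproj mulmxDr mulmx1 mulmxDl mulmxN mulNmx.
by rewrite !mulmxA.
Qed.

(** Dependent columns stay dependent when a column is added. *)
Lemma det_gram_row_mx_singular (x : 'cV[R]_n) : \det G = 0 ->
  \det ((row_mx A x)^T *m row_mx A x) = 0.
Proof.
move=> /eqP /det0P[v v0 vG].
have vA : A *m v^T = 0.
  apply/eqP; have [//|] := eqVneq (A *m v^T) 0.
  move=> /qform1_gt0; rewrite /qform trmx_mul trmxK mulmx1 -mulmxA.
  by rewrite [A^T *m _]mulmxA mulmxA -/G vG mul0mx mxE ltxx.
apply/eqP/det0P; exists (row_mx v 0).
  apply: contra v0 => /eqP H; apply/eqP.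
  by rewrite -[v](@row_mxKl _ 1 r 1 v 0) H linear0.
have vA' : v *m A^T = 0 by rewrite -[v]trmxK -trmx_mul vA trmx0.
by rewrite tr_row_mx mulmxA mul_row_col vA' mul0mx addr0 mul0mx.
Qed.

Hypothesis uG : G \in unitmx.

Lemma tr_coproj : coproj^T = coproj.
Proof.
rewrite /coproj linearB/= trmx1 !trmx_mul trmxK trmx_inv trmx_mul trmxK.
by rewrite mulmxA.
Qed.

Lemma coproj_idem : coproj *m coproj = coproj.
Proof.
have AQ : A^T *m coproj = 0.
  by rewrite /coproj mulmxBr mulmx1 !mulmxA -/G mulmxV// mul1mx subrr.
by rewrite {1}/coproj mulmxBl mul1mx -(mulmxA _ A^T coproj) AQ mulmx0 subr0.
Qed.

Lemma qform_coproj_ge0 x : 0 <= qform coproj x.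
Proof. by rewrite qform_idem ?qform1_ge0// ?tr_coproj ?coproj_idem. Qed.

Lemma posdef_coproj (c : R) : - 1 < c -> posdef (1%:M + c *: coproj).
Proof.
move=> c1; split; first by rewrite linearD linearZ/= trmx1 tr_coproj.
move=> x x0; set y := coproj *m x.
have Ey : qform coproj x = qform 1%:M y.
  by rewrite qform_idem ?tr_coproj ?coproj_idem.
have Exy : qform 1%:M x = qform 1%:M y + qform 1%:M (x - y).
  rewrite -Ey -[in X in _ = _ + X](mul1mx x) -mulmxBl -qform_idem.
  - by rewrite -qformD addrCA subrr addr0.
  - by rewrite linearB/= trmx1 tr_coproj.
  - by rewrite mulmxBl mul1mx mulmxBr mulmx1 coproj_idem subrr subr0.
rewrite qformD qformZ Ey Exy.
have y0 := qform1_ge0 y; have z0 := qform1_ge0 (x - y).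
have [yE|/qform1_gt0 yn0] := eqVneq y 0.
  have := qform1_gt0 x0; rewrite Exy yE qform1 big1 => [|i _]; last by rewrite mxE expr0n.
  by rewrite mulr0 addr0.
have -> : qform 1%:M y + qform 1%:M (x - y) + c * qform 1%:M y =
  (c + 1) * qform 1%:M y + qform 1%:M (x - y) by ring.
by rewrite ltr_pwDl// mulr_gt0// -ltrBlDr sub0r.
Qed.

Lemma det_coproj (c : R) : (r <= n)%N -> - 1 < c ->
  \det (1%:M + c *: coproj) = (1 + c) ^+ (n - r).
Proof.
move=> rn c1; have c0 : 1 + c != 0 by rewrite gt_eqF// -ltrBlDl sub0r.
(* The two Schur complements of [M] give Sylvester's identity. *)
pose M := block_mx G A^T (c *: A) ((1 + c)%:M).
have dG0 : \det G != 0 by rewrite -unitfE -unitmxE.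
apply: (mulfI dG0).
transitivity (\det M).
  rewrite det_schur_ul//; congr (_ * \det _).
  rewrite /coproj scalerBr scalemx1 addrA -raddfD/= -scalemxAl -scalemxAl.
  by [].
rewrite det_schur_dr; last by rewrite unitmxE det_scalar unitfE expf_neq0.
rewrite det_scalar invmx_scalar mul_mx_scalar -scalemxAl -scalemxAr scalerA.
rewrite -/G -[X in X - _]scale1r -scalerBl detZ.
have -> : 1 - (1 + c)^-1 * c = (1 + c)^-1 by field.
by rewrite mulrA exprVn -expfB_cond ?(negPf c0) ?add0n// mulrC.
Qed.

End gram.

(** * Laplace transform of a Gaussian quadratic form *)

Section measurable_matrix.
Context d (S : measurableType d) (R : realType).

Lemma measurable_mulmx m n p (A : S -> 'M[R]_(m, n)) (B : S -> 'M[R]_(n, p)) :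
  (forall i j, measurable_fun setT (fun s => A s i j)) ->
  (forall i j, measurable_fun setT (fun s => B s i j)) ->
  forall i j, measurable_fun setT (fun s => (A s *m B s) i j).
Proof.
move=> mA mB i j; under eq_fun do rewrite mxE.
by apply: measurable_sum => k; exact: measurable_funM.
Qed.

Lemma measurable_det n (A : S -> 'M[R]_n) :
  (forall i j, measurable_fun setT (fun s => A s i j)) ->
  measurable_fun setT (fun s => \det (A s)).
Proof.
move=> mA; rewrite /determinant.
apply: measurable_sum => k; apply: measurable_funM => //.
by apply: measurable_prod => i _.
Qed.

Lemma measurable_qform n (M : 'M[R]_n) (x : S -> 'cV[R]_n) :
  (forall i, measurable_fun setT (fun s => x s i 0)) ->
  measurable_fun setT (fun s => qform M (x s)).
Proof.
move=> mx; apply: measurable_mulmx => [|i j]; last by rewrite ord1.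
apply: measurable_mulmx => // {}i {}j; rewrite ord1.
by under eq_fun do rewrite mxE; exact: mx.
Qed.

End measurable_matrix.

Section gauss_laplace.
Context d (T : measurableType d) (R : realType) (P : probability T R).
Local Open Scope ereal_scope.

(** Laplace transform of a Gaussian quadratic form, stated for the form
[S - 1%:M] so that positive definiteness of [S] is the exact condition of
convergence. The induction integrates the first coordinate. *)
Lemma gauss_laplace n (S : 'M[R]_n) (X : nat -> {RV P >-> R}) :
  iid_standard_normal X -> posdef S ->
  \int[P]_w (expR (- qform (S - 1%:M)%R (\col_(i < n) X i w) / 2))%:E =
  ((Num.sqrt (\det S))^-1)%:E.
Proof.
elim: n S X => [|n IH] S X iX pS.
  rewrite det_mx00 sqrtr1 invr1 (eq_integral (cst 1)); last first.
    by move=> w _; rewrite /qform mxE big_ord0 oppr0 mul0r expR0.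
  by rewrite integral_cst// mul1e; exact: probability_setT.
have [indX normX] := iX.
pose F (a : nat -> R) : \bar R :=
  (expR (- qform (S - 1%:M)%R (\col_(i < n.+1) a i) / 2))%:E.
rewrite -[LHS]/(\int[P]_w F (fun i => X i w)).
have F0 a : 0 <= F a by rewrite lee_fin expR_ge0.
have mF : array_measurable F.
  move=> d' S' c mc; apply/measurable_EFinP/measurableT_comp => //.
  apply: measurable_funM => //; apply: measurableT_comp => //.
  by apply: measurable_qform => i; under eq_fun do rewrite mxE; exact: mc.
rewrite (integral_splice indX (fun i => (0 < i)%N) mF F0).
pose S1 : 'M[R]_(1 + n) := S.
set s := (ulsubmx S1 0 0)%R.
have s0 : (0 < s)%R by exact: posdef_ul.
pose u := dlsubmx S1.
pose y w := (\col_(i < n) X i.+1 w)%R.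
have Fs w w' : F (splice (fun i => (0 < i)%N) (fun i => X i w) (fun i => X i w')) =
   (expR (- ((s - 1) * X 0%N w' ^+ 2 + (u^T *m y w)%R 0%R 0%R * X 0%N w' *+ 2) / 2))%:E *
   (expR (- qform (drsubmx S1 - 1%:M)%R (y w) / 2))%:E.
  rewrite /F.
  rewrite [X in qform _ X](_ : _ = (col_mx (X 0%N w')%:M (y w) : 'cV[R]_(1 + n))); last first.
    apply/colP => i; case: (@split_ordP 1 n i) => k ->.
      by rewrite col_mxEu !mxE !ord1.
    by rewrite col_mxEd !mxE.
  rewrite -EFinM -expRD; congr (expR _)%:E.
  have E1 : (1%:M : 'M[R]_(1 + n)) = block_mx 1%:M 0 0 1%:M by exact: scalar_mx_block.
  rewrite (@qform_col_mx _ n (S1 - 1%:M)); last first.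
    by rewrite linearB/= trmx1; congr (_ - _)%R; case: pS.
  rewrite -[in X in (- X / 2)%R](submxK S1) E1 opp_block_mx add_block_mx.
  rewrite block_mxKul block_mxKdl block_mxKdr subr0.
  have -> : (ulsubmx S1 - 1%:M)%R 0%R 0%R = (s - 1)%R.
    by rewrite mxE; congr (_ + _)%R; rewrite !mxE eqxx.
  by rewrite -!mulrDl -opprD.
have mq M : measurable_fun setT (fun w => expR (- qform M (y w) / 2)).
  apply: measurableT_comp => //; apply: measurable_funM => //.
  apply: measurableT_comp => //; apply: measurable_qform => i.
  by under eq_fun do rewrite mxE; exact: measurable_funPT.
have inner w : \int[P]_w' F (splice (fun i => (0 < i)%N) (X ^~ w) (X ^~ w')) =
    ((Num.sqrt s)^-1)%:E * (expR (- qform (schur_compl S1 - 1%:M)%R (y w) / 2))%:E.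
  under eq_integral do rewrite Fs.
  rewrite ge0_integralZr//; last first.
  - apply/measurable_EFinP; apply: measurableT_comp => //.
    apply: measurable_funM => //; apply: measurableT_comp => //.
    apply: measurable_funD; first by apply: measurable_funM => //; exact: measurable_funX.
    by under eq_fun do rewrite -mulrnAl; exact: measurable_funM.
  rewrite (integral_gaussian_exp_quad ((u^T *m y w)%R 0%R 0%R) (normX 0%N) s0).
  rewrite -!EFinM -[in LHS](mulrA (Num.sqrt s)^-1%R) -expRD; congr (_ * expR _)%:E.
  rewrite /schur_compl !qformD !qformN qformZ qform_outer -/u -/s; field.
  by rewrite gt_eqF.
under eq_integral do rewrite inner.
rewrite ge0_integralZl//; last exact/measurable_EFinP.
rewrite (IH _ (fun i => X i.+1)); last 2 first.
- by apply: (iid_standard_normal_comp (phi := succn)) => // i j [].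
- exact: posdef_schur_compl.
by rewrite -EFinM -invfM -sqrtrM ?(ltW s0)// -det_schur_compl.
Qed.

End gauss_laplace.

(** * Two integrals over the half-line *)

Section tail_integrals.
Context (R : realType).
Notation mu := (@lebesgue_measure R).

Lemma integral_expRN_y (a : R) : 0 < a ->
  (\int[mu]_(x in `[0%R, +oo[) (expR (- (x * a)))%:E = (a^-1)%:E)%E.
Proof.
move=> a0.
have cexp : continuous (fun x : R => expR (- (x * a))).
  move=> z; apply: continuous_comp; last exact: continuous_expR.
  by apply: (@continuousN _ R^o); apply: continuousM => //; exact: cst_continuous.
rewrite (@ge0_continuous_FTC2y _ _ (fun x => - (expR (- (x * a)) / a)) _ 0)//.
- by rewrite mul0r oppr0 expR0 div1r sub0e -EFinN opprK.
- exact: continuous_subspaceT.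
- rewrite -oppr0 -(mul0r a^-1); apply: cvgN; apply: cvgMl.
  rewrite (_ : (fun x => _) = (fun z => expR (- z)) \o (fun z => z * a)); last by [].
  apply: (@cvg_comp _ _ _ _ _ _ (pinfty_nbhs R)); last exact: cvgr_expR.
  exact: gt0_cvgMly.
- apply/cvg_at_right_filter; apply: cvgN; apply: cvgMl; exact: cexp.
- move=> x _; rewrite derive1E.
  have h1 : is_derive x 1 (fun x : R => - (x * a)) (- a).
    by apply: is_derive_eq; rewrite scaler0 add0r; congr (- _); exact: mulr1.
  have h2 := @is_derive1_comp _ expR (fun x : R => - (x * a)) _ _ _ (is_derive_expR _) h1.
  have h3 : is_derive x 1 (fun x => - ((expR \o (fun x => - (x * a))) x * a^-1))
     (- (expR (- (x * a)) * - a * a^-1)).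
    apply: is_derive_eq.
    rewrite scaler0 add0r; congr (- _); exact: mulrC.
  rewrite [LHS](@derive_val _ _ _ _ _ _ _ h3) mulrN mulNr opprK mulfK// gt_eqF//.
Qed.

Let is_derive_antiderivative (g a : R) : 0 < g -> 1 < a -> forall x, 0 < 1 + g * x ->
  is_derive x 1 (fun x => - ((1 + g * x) `^ (1 - a) / (g * (a - 1))))
    ((1 + g * x) `^ (- a)).
Proof.
move=> g0 a1 x x0.
have h1 : is_derive x 1 (fun x : R => 1 + g * x) g.
  by apply: is_derive_eq; rewrite add0r mul1r; exact: mulr1.
have h2 := is_derive1_powR (1 - a) x0.
have h3 := @is_derive1_comp _ (fun y : R => y `^ (1 - a)) (fun x : R => 1 + g * x) _ _ _ h2 h1.
have h4 : is_derive x 1 (fun x => - (((fun y : R => y `^ (1 - a)) \o (fun x : R => 1 + g * x)) x * (g * (a - 1))^-1))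
   (- ((1 - a) * (1 + g * x) `^ (1 - a - 1) * g * (g * (a - 1))^-1)).
  apply: is_derive_eq; rewrite scaler0 add0r; congr (- _).
  exact: mulrC.
have <- : - ((1 - a) * (1 + g * x) `^ (1 - a - 1) * g * (g * (a - 1))^-1) =
    (1 + g * x) `^ (- a).
  rewrite addrAC subrr add0r; field.
  by rewrite subr_eq0 gt_eqF//= gt_eqF.
exact: h4.
Qed.

Lemma integral_powR_y (g a : R) : 0 < g -> 1 < a ->
  (\int[mu]_(x in `[0%R, +oo[) ((1 + g * x) `^ (- a))%:E = ((g * (a - 1))^-1)%:E)%E.
Proof.
move=> g0 a1.
have lin0 x : 0 <= x -> 0 < 1 + g * x.
  by move=> x0; rewrite ltr_pwDl// mulr_ge0// ltW.
rewrite (@ge0_continuous_FTC2y _ _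
  (fun x => - ((1 + g * x) `^ (1 - a) / (g * (a - 1)))) _ 0)//.
- by rewrite mulr0 addr0 powR1 div1r sub0e -EFinN opprK.
- by move=> x _; exact: powR_ge0.
- apply: continuous_in_subspaceT => x; rewrite inE/= in_itv/= andbT => x0.
  have h1 : is_derive x 1 (fun x : R => 1 + g * x) g.
    by apply: is_derive_eq; rewrite add0r mul1r; exact: mulr1.
  have h2 := is_derive1_powR (- a) (lin0 x x0).
  have [+ _] := @is_derive1_comp _ (fun y : R => y `^ (- a)) (fun x : R => 1 + g * x) _ _ _ h2 h1.
  by move=> /derivable1_diffP/differentiable_continuous.
- rewrite -oppr0 -(mul0r (g * (a - 1))^-1); apply: cvgN; apply: cvgMl.
  have lny : ln (1 + g * x) * (a - 1) @[x --> +oo%R] --> +oo%R.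
    apply: gt0_cvgMly; first by rewrite subr_gt0.
    apply/cvgryPge => A; near=> x.
    have x1 : expR A / g <= x by near: x; apply: nbhs_pinfty_ge; exact: num_real.
    rewrite -[A]expRK ler_ln ?posrE ?expR_gt0//; last first.
      by apply: lin0; rewrite (le_trans _ x1)// divr_ge0 ?expR_ge0// ltW.
    by rewrite (le_trans (y := g * x)) ?lerDr// -ler_pdivrMl// mulrC.
  have := @cvg_comp _ _ _ _ (fun z => expR (- z)) _ (pinfty_nbhs R) _ lny (@cvgr_expR R).
  apply: cvg_trans; apply: near_eq_cvg; near=> x.
  have x0 : 0 < 1 + g * x.
    by apply: lin0; near: x; apply: nbhs_pinfty_ge; exact: num_real.
  have -> : (1 + g * x) `^ (1 - a) = expR ((1 - a) * ln (1 + g * x)).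
    by rewrite /powR (gt_eqF x0).
  congr (expR _); rewrite -[1 - a]opprB mulNr; congr (- _); exact: mulrC.
- by move=> x x0; apply: ex_derive; apply: is_derive_antiderivative => //; apply/lin0/ltW.
- apply/cvg_at_right_filter.
  have [+ _] := is_derive_antiderivative g0 a1 (lin0 0 (lexx _)).
  by move=> /derivable1_diffP/differentiable_continuous.
- move=> x; rewrite in_itv/= andbT => x0; rewrite derive1E.
  by have [_ ->] := is_derive_antiderivative g0 a1 (lin0 x (ltW x0)).
Unshelve. all: by end_near. Qed.
End tail_integrals.

(** * Adding one Gaussian column to a matrix *)

Lemma det_gram_ge0 (R : realFieldType) n r (A : 'M[R]_(n, r)) :
  0 <= \det (A^T *m A).
Proof.
elim: r A => [|r IH] A; first by rewrite det_mx00.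
move: A; rewrite -addn1 => A; rewrite -[A]hsubmxK.
have := IH (lsubmx A); rewrite le_eqVlt => /predU1P[/esym g0|g0].
  by rewrite det_gram_row_mx_singular.
have uG : (lsubmx A)^T *m lsubmx A \in unitmx by rewrite unitmxE unitfE gt_eqF.
by rewrite det_gram_row_mx// mulr_ge0 ?qform_coproj_ge0// ltW.
Qed.

Section column_moments.
Context d (T : measurableType d) (R : realType) (P : probability T R).
Context (X : nat -> {RV P >-> R}) (iX : iid_standard_normal X).
Context (n r : nat) (rn : (r <= n)%N) (A : 'M[R]_(n, r)).
Local Open Scope ereal_scope.

Let x w : 'cV[R]_n := (\col_(i < n) X i w)%R.
Let g : R := \det (A^T *m A).
Let D w : R := \det ((row_mx A (x w))^T *m row_mx A (x w)).

Let g0 : (0 <= g)%R. Proof. exact: det_gram_ge0. Qed.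
Let D0 w : (0 <= D w)%R. Proof. exact: det_gram_ge0. Qed.

Let mD : measurable_fun setT D.
Proof.
have mA i j : measurable_fun setT (fun w => row_mx A (x w) i j).
  under eq_fun do rewrite mxE; case: fintype.split => k; first exact: measurable_cst.
  by rewrite /x; under eq_fun do rewrite mxE; exact: measurable_funPT.
apply: measurable_det; apply: measurable_mulmx => i j //.
by under eq_fun do rewrite mxE; exact: mA.
Qed.

Let Dsing w : g = 0%R -> D w = 0%R.
Proof. exact: det_gram_row_mx_singular. Qed.

(** [D w] is the Gram determinant of [A] followed by the Gaussian column
[x w], and [g] that of [A]. *)
Lemma laplace_gram (l : R) : (0 < 1 + 2 * l * g)%R ->
  \int[P]_w (expR (- (l * D w)))%:E =
  ((Num.sqrt ((1 + 2 * l * g) ^+ (n - r)))^-1)%:E.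
Proof.
move=> lg; have [gE|gN0] := eqVneq g 0%R.
  rewrite gE mulr0 addr0 expr1n sqrtr1 invr1.
  rewrite (eq_integral (cst 1)); last first.
    by move=> w _; rewrite Dsing// mulr0 oppr0 expR0.
  by rewrite integral_cst// mul1e; exact: probability_setT.
have uG : A^T *m A \in unitmx by rewrite unitmxE unitfE.
have c1 : (- 1 < 2 * l * g)%R by rewrite -subr_gt0 opprK addrC.
rewrite -(det_coproj uG rn c1) -(gauss_laplace iX); last exact: posdef_coproj.
apply: eq_integral => w _; congr (expR _)%:E.
rewrite /D det_gram_row_mx// -/g addrC addrA addNr add0r qformZ.
by rewrite -/(x w); field.
Qed.

Lemma integral_gram_le : \int[P]_w (D w)%:E <= ((n - r)%:R * g)%:E.
Proof.
have [gE|gN0] := eqVneq g 0%R.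
  rewrite (eq_integral (cst 0)); last by move=> w _; rewrite Dsing.
  by rewrite integral_cst// mul0e gE mulr0.
have gp : (0 < g)%R by rewrite lt_def gN0.
set k := (n - r)%N; set m := \int[P]_w (D w)%:E.
have m0 : 0 <= m by apply: integral_ge0 => w _; rewrite lee_fin.
(* From 1 + u <= expR u and the Laplace transform at - t / g. *)
have key (t : R) : (0 < t)%R -> (k.+2%:R * t < 1)%R ->
    1 + (t / g)%:E * m <= ((1 - k%:R * t / (1 - 2 * t))^-1)%:E.
  move=> t0 kt.
  have t2 : (0 < 1 - 2 * t)%R.
    by rewrite subr_gt0 (le_lt_trans _ kt)// ler_wpM2r ?(ltW t0)// ler_nat.
  have v1 : (0 < 1 - k%:R * t / (1 - 2 * t))%R.
    by rewrite subr_gt0 ltr_pdivrMr// mul1r ltrBrDr -mulrDl -natrD addn2.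
  have sq : (1 - k%:R * t / (1 - 2 * t) <= Num.sqrt ((1 - 2 * t) ^+ k))%R.
    have h : (expR (- (2 * t / (1 - 2 * t))) <= 1 - 2 * t)%R.
      rewrite expRN -[leRHS]invrK lef_pV2 ?posrE ?expR_gt0 ?invr_gt0//.
      apply: le_trans (expR_ge1Dx _); rewrite le_eqVlt; apply/orP; left.
      by apply/eqP; field; rewrite gt_eqF.
    apply: le_trans (expR_ge1Dx _) _.
    rewrite -[leLHS]ger0_norm ?expR_ge0// -sqrtr_sqr ler_sqrt ?exprn_ge0 ?(ltW t2)//.
    apply: le_trans (lerXn2r _ _ _ h); rewrite ?nnegrE ?expR_ge0 ?(ltW t2)//.
    by rewrite -!expRM_natl ler_expR le_eqVlt; apply/orP; left; apply/eqP; field; rewrite gt_eqF.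
  have lE : (1 + 2 * (- t / g) * g = 1 - 2 * t)%R by field; rewrite gt_eqF.
  have := @laplace_gram (- t / g)%R; rewrite lE => /(_ t2) L.
  apply: (@le_trans _ _ (\int[P]_w (expR (- (- t / g * D w)))%:E)); last first.
    by rewrite L lee_fin lef_pV2 ?posrE// (lt_le_trans v1).
  have {1}-> : 1 = \int[P]_w (cst 1 w).
    by rewrite integral_cst// mul1e; exact/esym/probability_setT.
  have tg : (0 <= t / g)%R by rewrite divr_ge0 ?ltW.
  rewrite -ge0_integralZl//; try exact/measurable_EFinP; try (by move=> w _; rewrite lee_fin).
  rewrite -ge0_integralD//; last 2 first.
  - by move=> w _; rewrite -EFinM lee_fin mulr_ge0.
  - by apply/measurable_EFinP; exact: measurable_funM.
  apply: ge0_le_integral => //.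
  - by move=> w _; rewrite /cst -EFinM -EFinD lee_fin addr_ge0// mulr_ge0.
  - by apply/measurable_EFinP; apply: measurable_funD => //; exact: measurable_funM.
  - apply/measurable_EFinP; apply: measurableT_comp => //.
    by apply: measurableT_comp => //; exact: measurable_funM.
  - move=> w _; rewrite /cst -EFinM -EFinD lee_fin.
    by rewrite !mulNr opprK; exact: expR_ge1Dx.
(* The integral is finite, and the previous bound can be solved for it. *)
have keyR (t : R) : (0 < t)%R -> (k.+2%:R * t < 1)%R ->
    exists2 u : R, m = u%:E & (u * (1 - k.+2%:R * t) <= k%:R * g)%R.
  move=> t0 kt; have := key t t0 kt; case E0 : m m0 => [u|//|//].
    rewrite lee_fin => u0; rewrite -EFinM -EFinD lee_fin => H; exists u => //.
    have t2 : (0 < 1 - 2 * t)%R.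
      by rewrite subr_gt0 (le_lt_trans _ kt)// ler_wpM2r ?(ltW t0)// ler_nat.
    have kt' : (0 < 1 - k.+2%:R * t)%R by rewrite subr_gt0.
    have E : ((1 - k%:R * t / (1 - 2 * t))^-1 - 1 = k%:R * t / (1 - k.+2%:R * t))%R.
      have kE : (k.+2%:R = k%:R + 2 :> R)%R by rewrite -natrD addn2.
      rewrite kE in kt' *; field.
      by rewrite !gt_eqF//= (_ : _ - _ = 1 - (k%:R + 2) * t)%R//; ring.
    move: H; rewrite -lerBrDl E ler_pdivlMr// => H.
    have -> : (u * (1 - k.+2%:R * t) = g / t * (t / g * u * (1 - k.+2%:R * t)))%R.
      by field; rewrite !gt_eqF.
    have -> : (k%:R * g = g / t * (k%:R * t))%R by field; rewrite gt_eqF.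
    by rewrite ler_wpM2l// divr_ge0 ?ltW.
  by rewrite gt0_muley ?lte_fin ?divr_gt0// addey.
have k2 : (0 < k.+2%:R :> R)%R by rewrite ltr0n.
have [||u mE _] := keyR ((k.+2%:R)^-1 / 2)%R; first by rewrite divr_gt0// invr_gt0.
  by rewrite mulrA mulfV ?gt_eqF// mul1r invf_lt1// ltr1n.
rewrite mE lee_fin; have u0 : (0 <= u)%R by move: m0; rewrite mE lee_fin.
(* Let [t] tend to 0. *)
apply/ler_addgt0Pr => e e0.
have ue : (0 < u + 1 + e)%R by rewrite addr_gt0// ltr_wpDl.
have [||u'] := keyR ((k.+2%:R)^-1 * (e / (u + 1 + e)))%R.
- by rewrite mulr_gt0 ?invr_gt0// divr_gt0.
- by rewrite mulrA mulfV ?gt_eqF// mul1r ltr_pdivrMr// mul1r ltrDr ltr_wpDl.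
rewrite mE => -[<-] H; apply: (le_trans _ (lerD H (lexx e))).
rewrite -lerBlDr mulrA mulfV ?gt_eqF// mul1r mulrBr mulr1 lerD2l lerN2.
by rewrite mulrCA ler_piMr ?(ltW e0)// ler_pdivrMr// mul1r -addrA lerDl addr_ge0 ?(ltW e0).
Qed.

(* With [a = 0] both sides are [+oo]. *)
Let inve_integral (a : R) : (0 <= a)%R ->
  (a%:E)^-1 = \int[lebesgue_measure]_(l in `[0%R, +oo[) (expR (- (l * a)))%:E.
Proof.
rewrite le_eqVlt => /predU1P[<-|a0].
  rewrite inve0 (eq_integral (cst 1)); last first.
    by move=> l _; rewrite mulr0 oppr0 expR0.
  by rewrite integral_cst//= mul1e lebesgue_measure_itv/= ltry addye.
by rewrite integral_expRN_y// inver gt_eqF.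
Qed.

(** The inverse moment is the integral over [l >= 0] of the Laplace transform. *)
Lemma integral_inv_gram_le : (2 < n - r)%N ->
  \int[P]_w ((D w)%:E)^-1 <= (((n - r - 2)%:R * g)%:E)^-1.
Proof.
move=> k3.
have [gE|gN0] := eqVneq g 0%R; first by rewrite gE mulr0 inve0 leey.
have gp : (0 < g)%R by rewrite lt_def gN0.
set k := (n - r)%N in k3 *.
set I := `[0%R, +oo[%classic : set (measurableTypeR R).
pose f (z : T * measurableTypeR R) : \bar R :=
  (expR (- (z.2 * D z.1)))%:E * (\1_I z.2)%:E.
have mI : measurable I by exact: measurable_itv.
have mf : measurable_fun setT f.
  apply: emeasurable_funM; apply/measurable_EFinP.
    apply: measurableT_comp => //; apply: measurableT_comp => //.
    by apply: measurable_funM => //; exact: measurableT_comp.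
  by apply: measurableT_comp => //; exact: measurable_indic.
have f0 z : 0 <= f z by rewrite /f -EFinM lee_fin mulr_ge0 ?expR_ge0.
have fE w : ((D w)%:E)^-1 = \int[lebesgue_measure]_l f (w, l).
  rewrite inve_integral// integral_mkcond; apply: eq_integral => l _.
  by rewrite /f epatch_indic.
under eq_integral do rewrite fE.
rewrite fubini_tonelli//.
rewrite (eq_integral ((fun l => ((1 + 2 * g * l) `^ (- (k%:R / 2)))%:E) \_ I)); last first.
  move=> l _; rewrite epatch_indic.
  rewrite /f /=; under eq_integral do rewrite muleC.
  rewrite ge0_integralZl//; last by apply/measurable_EFinP; apply: measurableT_comp => //; apply: measurableT_comp => //; apply: measurable_funM.
  rewrite indicE; case: (boolP (l \in I)) => [|_]; last by rewrite mul0e mule0.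
  rewrite inE /I/= in_itv/= andbT => l0; rewrite mul1e mule1.
  have lg : (0 < 1 + 2 * l * g)%R by rewrite ltr_pwDl// !mulr_ge0// ltW.
  rewrite laplace_gram//; congr (_%:E).
  have -> : (2 * g * l = 2 * l * g)%R by ring.
  rewrite -powR12_sqrt ?exprn_ge0 ?ltW// -powR_mulrn ?ltW// -powRrM powRN.
  by [].
rewrite -integral_mkcond integral_powR_y//; last 2 first.
- by rewrite mulr_gt0.
- by rewrite ltr_pdivlMr// mul1r ltr_nat.
rewrite inver gt_eqF; last by rewrite mulr_gt0// ltr0n subn_gt0.
rewrite lee_fin (_ : 2 * g * (k%:R / 2 - 1) = (k - 2)%:R * g)%R//.
by rewrite (natrB _ (ltnW k3)); field.
Qed.

Lemma gram_small_ball (eta : R) : (r < n)%N -> (0 < g)%R -> (0 < eta)%R ->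
  \int[P]_w ((D w <= eta * g)%R%:R)%:E <= (expR 1 * Num.sqrt eta)%:E.
Proof.
move=> rn' gp eta0.
have E0 : (0 < eta * g)%R by rewrite mulr_gt0.
have mB : measurable [set w | (D w <= eta * g)%R].
  rewrite -[X in measurable X]setTI; exact: measurable_fun_le.
rewrite (eq_integral (fun w => (\1_[set w | (D w <= eta * g)%R] w)%:E)); last first.
  move=> w _; rewrite indicE; congr (_%:R%:E).
  by case: (boolP (D w <= _)%R) => h; [rewrite mem_set|rewrite memNset//; exact/negP].
have lE : (1 + 2 * (eta * g)^-1 * g = 1 + 2 / eta)%R by field; rewrite !gt_eqF.
have le0 : (0 < 1 + 2 / eta)%R by rewrite ltr_pwDl// divr_ge0// ltW.
(* The indicator of [D w <= eta * g] is at most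
[expR (1 - D w / (eta * g))]. *)
apply: (@le_trans _ _ (\int[P]_w ((expR 1)%:E * (expR (- ((eta * g)^-1 * D w)))%:E))).
  apply: ge0_le_integral => //.
  - by apply/measurable_EFinP; exact: measurable_indic.
  - apply: emeasurable_funM => //; apply/measurable_EFinP; apply: measurableT_comp => //.
    by apply: measurableT_comp => //; exact: measurable_funM.
  - move=> w _; rewrite -EFinM lee_fin -expRD indicE.
    case: (boolP (w \in _)) => [|_]; last exact: expR_ge0.
    rewrite inE/= => Dw; rewrite -[leLHS]expR0 ler_expR subr_ge0.
    by rewrite mulrC ler_pdivrMr// mul1r.
rewrite ge0_integralZl//; last first.
  apply/measurable_EFinP; apply: measurableT_comp => //.
  by apply: measurableT_comp => //; exact: measurable_funM.
rewrite laplace_gram lE// -EFinM lee_fin ler_wpM2l ?expR_ge0//.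
rewrite -[leRHS]invrK lef_pV2 ?posrE ?invr_gt0 ?sqrtr_gt0 ?exprn_gt0//.
rewrite -sqrtrV ?(ltW eta0)// ler_sqrt ?exprn_ge0 ?(ltW le0)//.
have h : (1 <= 1 + 2 / eta)%R by rewrite lerDl divr_ge0// ltW.
apply: (@le_trans _ _ (1 + 2 / eta)%R).
  by rewrite ler_wpDl// -[leLHS]mul1r ler_wpM2r ?invr_ge0 ?ltW// ltr1n.
by rewrite -[leLHS]expr1 ler_weXn2l// subn_gt0.
Qed.

End column_moments.

(** * Moments of Gram determinants of Gaussian arrays *)

Section arrays.
Context (R : realType).
Implicit Types a x : nat * nat -> R.

(** The first [r] columns, cut to [n] rows, of an array. *)
Definition array_mx n r a : 'M[R]_(n, r) := \matrix_(i, j) a (val i, val j).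

(** The Gram determinant of these columns. *)
Definition gram n r a : R := \det ((array_mx n r a)^T *m array_mx n r a).

(** The squared norm of column [j]. *)
Definition sqnorm n j a : R := \sum_(i < n) a (val i, j) ^+ 2.

(** The product of the squared norms of the first [r] columns. *)
Definition sqnorms n r a : R := \prod_(j < r) sqnorm n j a.

(** The positions in the first [r] columns. *)
Definition before (r : nat) : pred (nat * nat) := fun ij => (ij.2 < r)%N.

Lemma gram0 n a : gram n 0 a = 1.
Proof. exact: det_mx00. Qed.

Lemma gram_ge0 n r a : 0 <= gram n r a.
Proof. exact: det_gram_ge0. Qed.

Lemma sqnorm_ge0 n j a : 0 <= sqnorm n j a.
Proof. by apply: sumr_ge0 => i _; exact: sqr_ge0. Qed.

Lemma sqnorms_ge0 n r a : 0 <= sqnorms n r a.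
Proof. by apply: prodr_ge0 => j _; exact: sqnorm_ge0. Qed.

Lemma sqnormsS n r a : sqnorms n r.+1 a = sqnorms n r a * sqnorm n r a.
Proof. by rewrite /sqnorms big_ord_recr. Qed.

Lemma gramS n r a x : gram n r.+1 (splice (before r) a x) =
  \det ((row_mx (array_mx n r a) (\col_(i < n) x (val i, r)))^T *m
        row_mx (array_mx n r a) (\col_(i < n) x (val i, r))).
Proof.
rewrite /gram -addn1.
suff -> : array_mx n (r + 1) (splice (before r) a x) =
  row_mx (array_mx n r a) (\col_(i < n) x (val i, r)) by [].
apply/matrixP => i j; rewrite [LHS]mxE /splice /before /=.
case: (split_ordP j) => k ->; first by rewrite row_mxEl mxE.
by rewrite row_mxEr mxE /= ord1 addn0.
Qed.

(** The squared norm of a column as its squared distance to the zero subspace. *)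
Lemma gram_row0 n (A : 'M[R]_(n, 0)) (y : 'cV[R]_n) :
  \det ((row_mx A y)^T *m row_mx A y) = \sum_i y i 0 ^+ 2.
Proof.
rewrite det_gram_row_mx ?unitmxE ?det_mx00 ?unitr1// mul1r /coproj.
by rewrite [A]thinmx0 !mul0mx subr0 qform1.
Qed.

Lemma sqnorm_splice n r a x : sqnorm n r (splice (before r) a x) = sqnorm n r x.
Proof. by apply: eq_bigr => i _; rewrite /splice /before /= ltnn. Qed.

Lemma sqnorms_splice n r a x : sqnorms n r (splice (before r) a x) = sqnorms n r a.
Proof.
apply: eq_bigr => j _; apply: eq_bigr => i _.
by rewrite /splice /before /= ltn_ord.
Qed.

Lemma gram_splice n r a x : gram n r (splice (before r) a x) = gram n r a.
Proof.
rewrite /gram; suff -> : array_mx n r (splice (before r) a x) = array_mx n r a by [].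
by apply/matrixP => i j; rewrite !mxE /splice /before /= ltn_ord.
Qed.

Lemma gram_measurable n r : array_measurable (fun a => (gram n r a)%:E).
Proof.
move=> d S c mc; apply/measurable_EFinP.
have m1 i j : measurable_fun setT (fun s => array_mx n r (c s) i j).
  by under eq_fun do rewrite mxE; exact: mc.
apply: measurable_det; apply: measurable_mulmx => i j //.
by under eq_fun do rewrite mxE; exact: m1.
Qed.

Lemma sqnorms_measurable n r : array_measurable (fun a => (sqnorms n r a)%:E).
Proof.
move=> d S c mc; apply/measurable_EFinP.
apply: measurable_prod => j _; apply: measurable_sum => i.
by apply: measurable_funX; exact: mc.
Qed.

Lemma inve_measurable (f : (nat * nat -> R) -> R) :
  (forall a, 0 <= f a) ->
  array_measurable (fun a => (f a)%:E) -> array_measurable (fun a => ((f a)%:E)^-1%E).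
Proof.
move=> f0 mf d S c mc; under eq_fun do rewrite inver -powR_inv1//.
have /measurable_EFinP mfc := mf _ _ _ mc.
apply: measurable_fun_ifT => //.
  by apply: measurable_fun_eqr.
by apply/measurable_EFinP; exact: (measurableT_comp (measurable_powR _)).
Qed.

End arrays.

Section gaussian_arrays.
Context d (T : measurableType d) (R : realType) (P : probability T R).
Context (B : nat * nat -> {RV P >-> R}) (iB : iid_standard_normal B).
Local Open Scope ereal_scope.

Let b w : nat * nat -> R := fun ij => B ij w.
Let col r : nat -> {RV P >-> R} := B \o (fun i => (i, r)).

Let icol r : iid_standard_normal (col r).
Proof. by apply: iid_standard_normal_comp => // i j []. Qed.

Let int1 : \int[P]_w (cst 1 w) = 1.
Proof. by rewrite integral_cst// mul1e; exact: probability_setT. Qed.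

Lemma measurable_array (F : (nat * nat -> R) -> \bar R) :
  array_measurable F -> measurable_fun setT (fun w => F (b w)).
Proof. by move=> mF; apply: mF => i; exact: measurable_funPT. Qed.

(** Integration of column [r], and of the later ones, with the first [r] columns
fixed. *)
Lemma integral_column_le (r : nat) (F g : (nat * nat -> R) -> \bar R) :
  array_measurable F -> (forall a, 0 <= F a) -> array_measurable g ->
  (forall a, \int[P]_w F (splice (before r) a (b w)) <= g a) ->
  \int[P]_w F (b w) <= \int[P]_w g (b w).
Proof.
move=> mF F0 mg Fg; case: iB => indB _.
rewrite /b (integral_splice indB (before r) mF F0).
apply: ge0_le_integral => //.
- by move=> w _; apply: integral_ge0.
- pose f (z : T * T) := F (splice (before r) (b z.1) (b z.2)).
  have mf : measurable_fun setT f.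
    apply: mF => i; rewrite /splice; case: (before r i).
      exact: measurableT_comp (@measurable_funPT _ _ _ _ (B i)) measurable_fst.
    exact: measurableT_comp (@measurable_funPT _ _ _ _ (B i)) measurable_snd.
  by apply: (measurable_fun_fubini_tonelli_F (m2 := P) f mf) => z; exact: F0.
- exact: measurable_array.
Qed.

Lemma integral_gram_ffact n r : (r <= n)%N ->
  \int[P]_w (gram n r (b w))%:E <= ((n ^_ r)%:R)%:E.
Proof.
elim: r => [_|r IH rn].
  rewrite (eq_integral (cst 1)); last by move=> w _; rewrite gram0.
  by rewrite int1 ffactn0.
apply: (@le_trans _ _ (\int[P]_w ((n - r)%:R * gram n r (b w))%:E)).
  apply: (integral_column_le (r := r) (F := fun a => (gram n r.+1 a)%:E)
    (g := fun a => ((n - r)%:R * gram n r a)%:E)).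
  - exact: gram_measurable.
  - by move=> a; rewrite lee_fin gram_ge0.
  - move=> d' S c mc; under eq_fun do rewrite EFinM.
    by apply: emeasurable_funM => //; exact: gram_measurable.
  - move=> a; under eq_integral do rewrite gramS.
    exact: (integral_gram_le (icol r) (ltnW rn)).
under eq_integral do rewrite EFinM.
rewrite ge0_integralZl//; last 2 first.
- exact: (measurable_array (@gram_measurable R n r)).
- by move=> w _; rewrite lee_fin gram_ge0.
rewrite ffactnSr natrM mulrC EFinM lee_wpmul2l// ?lee_fin//.
exact/IH/ltnW.
Qed.

Let inveM (u v : R) : (0 <= u)%R -> (0 <= v)%R ->
  ((u * v)%:E)^-1 = (u%:E)^-1 * (v%:E)^-1.
Proof.
rewrite le_eqVlt => /predU1P[<-|u0]; rewrite le_eqVlt => /predU1P[<-|v0].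
- by rewrite mul0r inve0 mulyy.
- by rewrite mul0r inve0 inver gt_eqF// gt0_mulye// lte_fin invr_gt0.
- by rewrite mulr0 inve0 inver gt_eqF// gt0_muley// lte_fin invr_gt0.
- by rewrite !inver !gt_eqF// ?mulr_gt0// invfM.
Qed.

Let inve_ge0' (u : R) : (0 <= u)%R -> 0 <= (u%:E)^-1.
Proof. by move=> u0; rewrite inver; case: ifP => // _; rewrite lee_fin invr_ge0. Qed.

Lemma integral_inv_gram_ffact n r : (r <= n - 2)%N ->
  \int[P]_w ((gram n r (b w))%:E)^-1 <= ((((n - 2) ^_ r)%:R)^-1)%:E.
Proof.
elim: r => [_|r IH rn].
  rewrite (eq_integral (cst 1)); last by move=> w _; rewrite gram0 inve1.
  by rewrite int1 ffactn0 invr1.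
have mI r' : array_measurable (fun a : nat * nat -> R => ((gram n r' a)%:E)^-1).
  by apply: inve_measurable; [exact: gram_ge0|exact: gram_measurable].
apply: (@le_trans _ _ (\int[P]_w (((n - r - 2)%:R * gram n r (b w))%:E)^-1)).
  apply: (integral_column_le (r := r) (F := fun a => ((gram n r.+1 a)%:E)^-1)
    (g := fun a => (((n - r - 2)%:R * gram n r a)%:E)^-1)).
  - exact: mI.
  - by move=> a; exact/inve_ge0'/gram_ge0.
  - move=> d' S c mc; under eq_fun do rewrite inveM ?gram_ge0//.
    by apply: emeasurable_funM => //; exact: mI.
  - move=> a; under eq_integral do rewrite gramS.
    apply: (integral_inv_gram_le (icol r)); lia.
under eq_integral do rewrite inveM ?gram_ge0//.
rewrite inver gt_eqF; last by rewrite ltr0n; lia.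
rewrite ge0_integralZl//; last 2 first.
- exact: (measurable_array (mI r)).
- by move=> w _; exact/inve_ge0'/gram_ge0.
rewrite ffactnSr natrM invfM mulrC EFinM subnAC lee_wpmul2l// ?lee_fin ?invr_ge0//.
exact/IH/ltnW.
Qed.

Lemma integral_sqnorms n r :
  \int[P]_w (sqnorms n r (b w))%:E <= (n%:R ^+ r)%:E.
Proof.
elim: r => [|r IH].
  rewrite (eq_integral (cst 1)); last by move=> w _; rewrite /sqnorms big_ord0.
  by rewrite int1 expr0.
have m0 a : (0 <= sqnorms n r a :> R)%R := sqnorms_ge0 n r a.
apply: (@le_trans _ _ (\int[P]_w (n%:R * sqnorms n r (b w))%:E)).
  apply: (integral_column_le (r := r) (F := fun a => (sqnorms n r.+1 a)%:E)
    (g := fun a => (n%:R * sqnorms n r a)%:E)).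
  - exact: sqnorms_measurable.
  - by move=> a; rewrite lee_fin sqnorms_ge0.
  - move=> d' S c mc; under eq_fun do rewrite EFinM.
    by apply: emeasurable_funM => //; exact: sqnorms_measurable.
  - move=> a; under eq_integral do rewrite sqnormsS sqnorms_splice sqnorm_splice EFinM.
    rewrite ge0_integralZl//; last 3 first.
    + apply/measurable_EFinP; apply: measurable_sum => i.
      by apply: measurable_funX; exact: measurable_funPT.
    + by move=> w _; rewrite lee_fin sqnorm_ge0.
    + by rewrite lee_fin.
    rewrite mulrC EFinM lee_wpmul2l// ?lee_fin//.
    have := integral_gram_le (icol r) (leq0n n) (0%R : 'M[R]_(n, 0)).
    rewrite subn0 det_mx00 mulr1; apply: le_trans; rewrite le_eqVlt; apply/orP; left.
    apply/eqP; apply: eq_integral => w _; rewrite gram_row0.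
    by congr (_%:E); apply: eq_bigr => i _; rewrite mxE.
under eq_integral do rewrite EFinM.
rewrite ge0_integralZl//; last 2 first.
- exact: (measurable_array (@sqnorms_measurable R n r)).
- by move=> w _; rewrite lee_fin sqnorms_ge0.
by rewrite exprS EFinM lee_wpmul2l// lee_fin.
Qed.

Lemma integral_inv_sqnorms n r : (2 < n)%N ->
  \int[P]_w ((sqnorms n r (b w))%:E)^-1 <= (((n - 2)%:R ^+ r)^-1)%:E.
Proof.
move=> n2; elim: r => [|r IH].
  rewrite (eq_integral (cst 1)); last by move=> w _; rewrite /sqnorms big_ord0 inve1.
  by rewrite int1 expr0 invr1.
have m0 a : (0 <= sqnorms n r a :> R)%R := sqnorms_ge0 n r a.
have mI r' : array_measurable (fun a : nat * nat -> R => ((sqnorms n r' a)%:E)^-1).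
  by apply: inve_measurable; [exact: sqnorms_ge0|exact: sqnorms_measurable].
have n20 : (0 < (n - 2)%:R :> R)%R by rewrite ltr0n subn_gt0.
apply: (@le_trans _ _ (\int[P]_w (((n - 2)%:R * sqnorms n r (b w))%:E)^-1)).
  apply: (integral_column_le (r := r) (F := fun a => ((sqnorms n r.+1 a)%:E)^-1)
    (g := fun a => (((n - 2)%:R * sqnorms n r a)%:E)^-1)).
  - exact: mI.
  - by move=> a; exact/inve_ge0'/sqnorms_ge0.
  - move=> d' S c mc; under eq_fun do rewrite inveM//.
    by apply: emeasurable_funM => //; exact: mI.
  - move=> a.
    under eq_integral do rewrite sqnormsS sqnorms_splice sqnorm_splice inveM ?sqnorm_ge0//.
    rewrite ge0_integralZl//; last 3 first.
    + apply: (measurable_array (F := fun a => ((sqnorm n r a)%:E)^-1)).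
      apply: inve_measurable; first exact: sqnorm_ge0.
      move=> d' S c mc; apply/measurable_EFinP; apply: measurable_sum => i.
      by apply: measurable_funX; exact: mc.
    + by move=> w _; exact/inve_ge0'/sqnorm_ge0.
    + exact: inve_ge0'.
    rewrite inveM// muleC lee_wpmul2r ?inve_ge0'//.
    have := integral_inv_gram_le (icol r) (leq0n n) (0%R : 'M[R]_(n, 0)).
    rewrite subn0 det_mx00 mulr1 => /(_ n2); apply: le_trans; rewrite le_eqVlt.
    apply/orP; left; apply/eqP; apply: eq_integral => w _; rewrite gram_row0.
    by congr (_%:E^-1); apply: eq_bigr => i _; rewrite mxE.
under eq_integral do rewrite inveM//.
rewrite inver gt_eqF//.
rewrite ge0_integralZl//; last 2 first.
- exact: (measurable_array (mI r)).
- by move=> w _; exact: inve_ge0'.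
by rewrite exprS invfM EFinM lee_wpmul2l// lee_fin invr_ge0.
Qed.

End gaussian_arrays.

(** * Typical arrays and the Borel-Cantelli argument *)

(** The array, cut to [n] rows, is typical if the Gram determinants and the
products of squared norms of its first [r] columns, and their inverses, are
below [n ^ 4] times the bounds on their means. The inverse Gram determinants
have such bounds for [r <= n - 2] only; instead, each of the last two columns
must keep a distance of more than [n ^ -2] from the span of the preceding
ones, provided that these are free. *)
Definition typical (R : realType) n (a : nat * nat -> R) :=
  [/\ forall r, (r <= n)%N -> gram n r a < n%:R ^+ 4 * (n ^_ r)%:R,
      forall r, (r <= n - 2)%N ->
        (((gram n r a)%:E)^-1 < (n%:R ^+ 4 / ((n - 2) ^_ r)%:R)%:E)%E,
      forall r, (n - 2 <= r < n)%N -> 0 < gram n r a ->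
        (n%:R ^+ 4)^-1 * gram n r a < gram n r.+1 a,
      forall r, (r <= n)%N -> sqnorms n r a < n%:R ^+ 4 * n%:R ^+ r &
      forall r, (r <= n)%N ->
        (((sqnorms n r a)%:E)^-1 < (n%:R ^+ 4 / (n - 2)%:R ^+ r)%:E)%E].

Section typical_arrays.
Context d (T : measurableType d) (R : realType) (P : probability T R).
Context (B : nat * nat -> {RV P >-> R}) (iB : iid_standard_normal B).
Local Open Scope ereal_scope.

Let b w : nat * nat -> R := fun ij => B ij w.

Lemma markov_ge (Y : T -> \bar R) (t K : R) : measurable_fun setT Y ->
  (forall w, 0 <= Y w) -> (0 < t)%R -> (0 < K)%R -> \int[P]_w Y w <= K%:E ->
  P [set w | (t * K)%:E <= Y w] <= (t^-1)%:E.
Proof.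
move=> mY Y0 t0 K0 YK.
have mE : measurable [set w | (t * K)%:E <= Y w].
  rewrite -[X in measurable X]setTI; exact: measurable_lee.
have tK : (0 < t * K)%R by rewrite mulr_gt0.
have H : (t * K)%:E * P [set w | (t * K)%:E <= Y w] <= K%:E.
  apply: le_trans YK; rewrite -[X in P X]setIT -integral_indic//.
  rewrite -ge0_integralZl//; last 2 first.
  - by apply/measurable_EFinP; exact: measurable_indic.
  - by rewrite lee_fin ltW.
  apply: ge0_le_integral => //.
  - by move=> w _; rewrite -EFinM lee_fin mulr_ge0// ltW.
  - apply: emeasurable_funM => //; apply/measurable_EFinP; exact: measurable_indic.
  - move=> w _; rewrite indicE; case: (boolP (w \in _)); last by rewrite mule0.
    by rewrite inE/= mule1.
have /fineK <- : P [set w | (t * K)%:E <= Y w] \is a fin_num by exact: fin_num_measure.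
have /fineK pE : P [set w | (t * K)%:E <= Y w] \is a fin_num by exact: fin_num_measure.
move: H; rewrite -pE -EFinM !lee_fin => H.
rewrite -[leRHS]mul1r ler_pdivlMr// -(ler_pM2r K0) mul1r.
by rewrite -mulrA mulrC.
Qed.

Lemma last_columns_small n r (eta : R) : (r < n)%N -> (0 < eta)%R ->
  P [set w | (0 < gram n r (b w))%R && (gram n r.+1 (b w) <= eta * gram n r (b w))%R]
    <= (expR 1 * Num.sqrt eta)%:E.
Proof.
move=> rn eta0.
pose E (a : nat * nat -> R) := (0 < gram n r a)%R && (gram n r.+1 a <= eta * gram n r a)%R.
pose F (a : nat * nat -> R) : \bar R := (E a)%:R%:E.
have mgram r' d' (S : measurableType d') (c : S -> nat * nat -> R) :
    (forall i, measurable_fun setT (fun s => c s i)) ->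
    measurable_fun setT (fun s => gram n r' (c s)).
  by move=> mc; apply/measurable_EFinP; exact: gram_measurable.
have mEb d' (S : measurableType d') (c : S -> nat * nat -> R) :
    (forall i, measurable_fun setT (fun s => c s i)) ->
    measurable_fun setT (fun s => E (c s)).
  move=> mc; apply: measurable_and.
    by apply: measurable_fun_ltr => //; exact: mgram.
  apply: measurable_fun_ler; first exact: mgram.
  by apply: measurable_funM => //; exact: mgram.
have mF : array_measurable F.
  move=> d' S c mc; apply/measurable_EFinP.
  rewrite (_ : (fun _ => _) = fun s => if E (c s) then 1%R else 0%R); last first.
    by apply/funext => s; case: (E (c s)).
  apply: measurable_fun_ifT => //; exact: mEb.
have mE : measurable [set w | E (b w)].
  rewrite -[X in measurable X]setTI.
  have := mEb _ _ b (fun i => @measurable_funPT _ _ _ _ (B i)).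
  by move=> /(_ measurableT [set true]); apply.
rewrite -[X in P X]/[set w | E (b w)].
rewrite -[X in P X]setIT -integral_indic//.
rewrite (eq_integral (fun w => F (b w))); last first.
  move=> w _; rewrite indicE /F; case: (boolP (E (b w))) => Ew.
    by rewrite mem_set.
  by rewrite memNset//; exact/negP.
apply: (@le_trans _ _ (\int[P]_w (cst (expR 1 * Num.sqrt eta)%:E w))); last first.
  rewrite integral_cst// [X in _ * X](_ : _ = 1) ?mule1//; exact: probability_setT.
have c0 : (0 <= expR 1 * Num.sqrt eta :> R)%R by rewrite mulr_ge0 ?expR_ge0 ?sqrtr_ge0.
apply: (integral_column_le iB (r := r) (F := F)
  (g := fun=> (expR 1 * Num.sqrt eta)%:E)) => //.
- by move=> a; rewrite lee_fin.
- move=> a; rewrite /F /E.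
  have [g0|g0] := ltP 0%R (gram n r a); last first.
    rewrite (eq_integral (cst 0)); first by rewrite integral_cst// mul0e lee_fin.
    by move=> w _; rewrite gram_splice ltNge g0.
  have icol : iid_standard_normal (B \o (fun i => (i, r))).
    by apply: iid_standard_normal_comp iB => i j [].
  have H := @gram_small_ball _ _ _ _ _ icol _ _ (ltnW rn) (array_mx n r a) eta rn g0 eta0.
  apply: le_trans H; rewrite le_eqVlt; apply/orP; left; apply/eqP.
  by apply: eq_integral => w _; rewrite gram_splice g0 gramS.
Qed.

Let mgramE n r : measurable_fun setT (fun w => (gram n r (b w))%:E).
Proof. exact: (measurable_array B (@gram_measurable R n r)). Qed.

Let msqE n r : measurable_fun setT (fun w => (sqnorms n r (b w))%:E).
Proof. exact: (measurable_array B (@sqnorms_measurable R n r)). Qed.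

Let minv (f : (nat * nat -> R) -> R) : (forall a, (0 <= f a)%R) ->
  array_measurable (fun a => (f a)%:E) ->
  measurable_fun setT (fun w => ((f (b w))%:E)^-1).
Proof. by move=> f0 mf; apply: (measurable_array B (inve_measurable f0 mf)). Qed.

Let mset (Y : T -> \bar R) (c : R) : measurable_fun setT Y ->
  measurable [set w | c%:E <= Y w].
Proof.
by move=> mY; rewrite -[X in measurable X]setTI; exact: measurable_lee.
Qed.

Lemma not_typical_le n : (2 < n)%N -> exists2 E : set T,
  measurable E /\ P E <= ((4 + 2 * expR 1) / n%:R ^+ 2)%:E &
  forall w, ~ E w -> typical n (b w).
Proof.
move=> n2.
have n0 : (0 < n%:R :> R)%R by rewrite ltr0n; lia.
have n20 : (0 < (n - 2)%:R :> R)%R by rewrite ltr0n; lia.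
set t := (n%:R ^+ 4 : R)%R; have t0 : (0 < t)%R by rewrite exprn_gt0.
(* One event for each clause of [typical]. *)
pose E1 r := [set w | (t * (n ^_ r)%:R)%:E <= (gram n r (b w))%:E].
pose E2 r := if (r <= n - 2)%N then
  [set w | (t / ((n - 2) ^_ r)%:R)%:E <= ((gram n r (b w))%:E)^-1] else set0.
pose E4 r := [set w | (t * n%:R ^+ r)%:E <= (sqnorms n r (b w))%:E].
pose E5 r := [set w | (t / (n - 2)%:R ^+ r)%:E <= ((sqnorms n r (b w))%:E)^-1].
pose E3 r := [set w | (0 < gram n r (b w))%R &&
  (gram n r.+1 (b w) <= t^-1 * gram n r (b w))%R].
have inv_ge0 (u : R) : (0 <= u)%R -> 0 <= (u%:E)^-1.
  by move=> u0; rewrite inver; case: ifP => // _; rewrite lee_fin invr_ge0.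
have mg r : measurable_fun setT (fun w => ((gram n r (b w))%:E)^-1).
  by apply: minv => //; [exact: gram_ge0|exact: gram_measurable].
have ms r : measurable_fun setT (fun w => ((sqnorms n r (b w))%:E)^-1).
  by apply: minv => //; [exact: sqnorms_ge0|exact: sqnorms_measurable].
have m1 r : measurable (E1 r) by exact: mset.
have m2 r : measurable (E2 r) by rewrite /E2; case: ifP => // _; exact: mset.
have m4 r : measurable (E4 r) by exact: mset.
have m5 r : measurable (E5 r) by exact: mset.
have m3 r : measurable (E3 r).
  rewrite -[X in measurable X]setTI.
  have mgr r' : measurable_fun setT (fun w => gram n r' (b w)) by apply/measurable_EFinP; exact: mgramE.
  suff : measurable_fun setT (fun w => (0 < gram n r (b w))%R &&
    (gram n r.+1 (b w) <= t^-1 * gram n r (b w))%R).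
    by move=> /(_ measurableT [set true]); apply.
  apply: measurable_and; first exact: measurable_fun_ltr.
  by apply: measurable_fun_ler => //; exact: measurable_funM.
have p1 r : (r <= n)%N -> P (E1 r) <= (t^-1)%:E.
  move=> rn; apply: markov_ge => //; last exact: integral_gram_ffact.
  - by move=> w; rewrite lee_fin gram_ge0.
  - by rewrite ltr0n ffact_gt0.
have p2 r : P (E2 r) <= (t^-1)%:E.
  rewrite /E2; case: ifPn => rn; last by rewrite measure0 lee_fin invr_ge0 ltW.
  apply: markov_ge => //; last exact: integral_inv_gram_ffact.
  - by move=> w; exact/inv_ge0/gram_ge0.
  - by rewrite invr_gt0 ltr0n ffact_gt0.
have p4 r : P (E4 r) <= (t^-1)%:E.
  apply: markov_ge => //; last exact: integral_sqnorms.
  - by move=> w; rewrite lee_fin sqnorms_ge0.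
  - by rewrite exprn_gt0.
have p5 r : P (E5 r) <= (t^-1)%:E.
  apply: markov_ge => //; last exact: integral_inv_sqnorms.
  - by move=> w; exact/inv_ge0/sqnorms_ge0.
  - by rewrite invr_gt0 exprn_gt0.
have p3 r : (r < n)%N -> P (E3 r) <= (expR 1 / n%:R ^+ 2)%:E.
  move=> rn; have t0' : (0 < t^-1)%R by rewrite invr_gt0.
  have sqt : (Num.sqrt t^-1 = (n%:R ^+ 2)^-1 :> R)%R.
    by rewrite sqrtrV ?(ltW t0)// /t (exprM _ 2 2) sqrtr_sqr ger0_norm ?exprn_ge0.
  by have := last_columns_small rn t0'; rewrite sqt.
pose A r := (E1 r `|` E2 r) `|` (E4 r `|` E5 r).
have mA r : measurable (A r) by do !apply: measurableU.
have pA r : (r <= n)%N -> P (A r) <= (4 / t)%:E.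
  move=> rn; apply: le_trans (measureU2 _ _ _) _; [exact: measurableU|exact: measurableU|].
  have -> : (4 / t = (t^-1 + t^-1) + (t^-1 + t^-1))%R by ring.
  rewrite EFinD; apply: leeD; (apply: le_trans (measureU2 _ _ _) _ => //);
    by rewrite EFinD; apply: leeD; first [exact: p1|exact: p2|exact: p4|exact: p5].
exists (\big[setU/set0]_(r < n.+1) A r `|` (E3 (n - 2)%N `|` E3 (n - 1)%N)).
  have mbig : measurable (\big[setU/set0]_(r < n.+1) A r).
    by apply: bigsetU_measurable.
  split; first by do !apply: measurableU.
  apply: le_trans (measureU2 _ _ _) _ => //; first exact: measurableU.
  have -> : ((4 + 2 * expR 1) / n%:R ^+ 2 = 4 / n%:R ^+ 2 +
     (expR 1 / n%:R ^+ 2 + expR 1 / n%:R ^+ 2) :> R)%R.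
    by field; rewrite gt_eqF.
  rewrite EFinD; apply: leeD; last first.
    apply: le_trans (measureU2 _ _ _) _ => //.
    by rewrite EFinD; apply: leeD; apply: p3; lia.
  apply: le_trans (Boole_inequality _ _) _ => //.
  apply: (@le_trans _ _ (\sum_(r < n.+1) (4 / t)%:E)).
    by apply: lee_sum => r _; apply: pA; rewrite -ltnS.
  rewrite sumEFin lee_fin sumr_const card_ord -[leLHS]mulr_natr.
  have -> : (4 / t * n.+1%:R = 4 / n%:R ^+ 2 * (n.+1%:R / n%:R ^+ 2))%R.
    by rewrite /t; field; rewrite gt_eqF.
  rewrite ler_piMr ?divr_ge0 ?exprn_ge0 ?(ltW n0)//.
  by rewrite ler_pdivrMr ?exprn_gt0// mul1r -natrX ler_nat; nia.
move=> w Ew.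
have AN r : (r <= n)%N -> ~ A r w.
  move=> rn Aw; apply: Ew; left.
  exact: (@bigsetU_sup _ _ n.+1 A rn w Aw).
split.
- move=> r /AN Ar; rewrite ltNge; apply/negP => h; apply: Ar.
  by left; left; rewrite /E1/= lee_fin.
- move=> r rn; have /AN Ar : (r <= n)%N by lia.
  rewrite ltNge; apply/negP => h; apply: Ar.
  by left; right; rewrite /E2 rn.
- move=> r /andP[r1 r2] g0; rewrite ltNge; apply/negP => h; apply: Ew; right.
  have [rE|rN] := eqVneq r (n - 2)%N; [left|right].
    by rewrite -rE /E3/=; apply/andP.
  have -> : (n - 1 = r)%N by lia.
  by rewrite /E3/=; apply/andP.
- move=> r /AN Ar; rewrite ltNge; apply/negP => h; apply: Ar.
  by right; left; rewrite /E4/= lee_fin.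
- move=> r /AN Ar; rewrite ltNge; apply/negP => h; apply: Ar.
  by right; right.
Qed.

Lemma ae_eventually_typical :
  {ae P, forall w, \forall n \near \oo, typical n (b w)}.
Proof.
pose c : R := (4 + 2 * expR 1)%R.
have c0 : (0 <= c)%R by rewrite addr_ge0// mulr_ge0// expR_ge0.
have /choice[E HE] k : exists E : set T, [/\ measurable E,
    P E <= (c / k.+3%:R ^+ 2)%:E & forall w, ~ E w -> typical k.+3 (b w)].
  by have [E [mE PE] EN] := @not_typical_le k.+3 isT; exists E.
have mE k : measurable (E k) by have [] := HE k.
exists (lim_sup_set E); split.
- by apply: bigcapT_measurable => k; apply: bigcup_measurable => j _.
- apply: lim_sup_set_cvg0 => //.
  (* 1 / (k + 3) ^ 2 <= 1 / (k + 1) - 1 / (k + 2), which telescopes. *)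
  have PEk k : P (E k) <= (c * (k.+1%:R^-1 - k.+2%:R^-1))%:E.
    have [_ + _] := HE k; move=> /le_trans; apply; rewrite lee_fin ler_wpM2l//.
    have k0 : (0 <= k%:R :> R)%R by [].
    have E1 : (k.+1%:R = k%:R + 1 :> R)%R by rewrite -natr1.
    have E2 : (k.+2%:R = k%:R + 2 :> R)%R by rewrite -addn2 natrD.
    have E3 : (k.+3%:R = k%:R + 3 :> R)%R by rewrite -addn3 natrD.
    have -> : (k.+1%:R^-1 - k.+2%:R^-1 = (k.+1%:R * k.+2%:R)^-1 :> R)%R.
      by rewrite E1 E2; field; rewrite !gt_eqF// ltr_wpDl.
    rewrite lef_pV2 ?posrE ?exprn_gt0 ?mulr_gt0// -natrX -natrM ler_nat.
    by rewrite expnS expn1; nia.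
  apply: (@le_lt_trans _ _ c%:E); last by rewrite ltry.
  have cv := @is_cvg_nneseries _ (fun k => P (E k)) xpredT 0 (fun k _ _ => measure_ge0 P (E k)).
  apply: (lime_le cv); apply: nearW => N.
  apply: (@le_trans _ _ (\sum_(0 <= k < N) (c * (k.+1%:R^-1 - k.+2%:R^-1))%:E)).
    by apply: lee_sum => k _; exact: PEk.
  rewrite sumEFin lee_fin -mulr_sumr ler_piMr//.
  under eq_bigr do rewrite -opprB.
  rewrite sumrN telescope_sumr// opprB invr1 lerBlDr lerDl invr_ge0//.
- move=> w /= Hw; apply: contrapT => Ew; apply: Hw.
  move: Ew; rewrite /lim_sup_set => /existsNP[N] /not_implyP[_ HN].
  exists N.+3 => // n /= Nn.
  have nE : n = (n - 3).+3 by lia.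
  rewrite nE; have [_ _] := HE (n - 3)%N; apply => Enw; apply: HN.
  by exists (n - 3)%N => //=; lia.
Qed.

End typical_arrays.

(** * Asymptotics of falling factorials and of J *)

Section asymptotics.
Context (R : realType).

(** A weak form of the Stirling formula. *)
Lemma ln_fact_approx (m n : nat) : (m <= n)%N -> (0 < n)%N ->
  `|ln (m`!%:R : R) - (m%:R * ln m%:R - m%:R)| <= 1 + ln n%:R.
Proof.
move=> mn n0; have Ln0 : 0 <= ln n%:R :> R by rewrite ln_ge0// ler1n.
case: m mn => [|m] mn.
  by rewrite fact0 ln1 mul0r !subr0 normr0 addr_ge0.
suff [lo hi] : m.+1%:R * ln m.+1%:R - m.+1%:R + 1 <= ln (m.+1`!%:R : R) /\
    ln (m.+1`!%:R : R) <= m.+1%:R * ln m.+1%:R - m.+1%:R + 1 + ln m.+1%:R.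
  have le : ln m.+1%:R <= ln n%:R :> R by rewrite ler_ln ?posrE ?ltr0n// ler_nat.
  by rewrite ler_norml; apply/andP; split; lra.
elim: m {mn} => [|m [lo hi]]; first by rewrite (_ : 1`! = 1)%N // ln1 mulr0 add0r addNr addr0 lexx.
have m0 : 0 < m.+1%:R :> R by rewrite ltr0n.
have m1 : 0 < m.+2%:R :> R by rewrite ltr0n.
have mE : m.+2%:R = m.+1%:R + 1 :> R by rewrite -natr1.
have fE : ln (m.+2`!%:R : R) = ln m.+2%:R + ln m.+1`!%:R.
  by rewrite factS natrM lnM ?posrE ?ltr0n ?fact_gt0.
set x := m.+1%:R in m0 mE lo hi *; set y := m.+2%:R in m1 mE fE *.
have h1 : x * (ln y - ln x) <= 1.
  rewrite -ln_div ?posrE// (_ : y / x = 1 + x^-1); last by rewrite mE; field; rewrite gt_eqF.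
  rewrite mulrC -ler_pdivlMr// div1r le_ln1Dx//.
  by rewrite (lt_trans (ltrN10 _))// invr_gt0.
have h2 : 1 <= y * (ln y - ln x).
  rewrite mulrC -ler_pdivrMr// div1r -opprB lerNr -ln_div ?posrE//.
  rewrite (_ : x / y = 1 + - y^-1); last first.
    have y0 : y != 0 by rewrite gt_eqF.
    by apply: (mulIf y0); rewrite mulfVK// mulrDl mulNr mulVf// mul1r mE addrK.
  apply: le_ln1Dx; rewrite ltrN2 invf_lt1// /y ltr1n//.
rewrite fE; split; nra.
Qed.

(** The function J on nonnegative reals; the convention [ln 0 = 0] gives
[calJr 0 = 1]. *)
Definition calJr (u : R) : R := u * ln u - u + 1.

Lemma calJE (u : R) : 0 <= u -> calJ u = (calJr u)%:E.
Proof.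
rewrite /calJ /calJr le_eqVlt => /predU1P[<-|->//].
by rewrite ltxx eqxx mul0r sub0r oppr0 add0r.
Qed.

Lemma ln_ffact_approx (n r : nat) : (r <= n)%N -> (0 < n)%N ->
  `|ln ((n ^_ r)%:R : R) - r%:R * ln n%:R + n%:R * calJr (1 - r%:R / n%:R)|
    <= 2 + 2 * ln n%:R.
Proof.
move=> rn n0; have n0' : 0 < n%:R :> R by rewrite ltr0n.
have Hn := ln_fact_approx (leqnn n) n0.
have Hr := ln_fact_approx (leq_subr r n) n0.
have E : ln (n`!%:R : R) = ln (n ^_ r)%:R + ln (n - r)`!%:R.
  by rewrite -(ffact_fact rn) natrM lnM ?posrE ?ltr0n ?fact_gt0// ffact_gt0.
have EJ : n%:R * calJr (1 - r%:R / n%:R) =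
    (n - r)%:R * ln (n - r)%:R - (n - r)%:R * ln n%:R - (n - r)%:R + n%:R :> R.
  have -> : 1 - r%:R / n%:R = (n - r)%:R / n%:R :> R.
    by rewrite natrB//; field; rewrite gt_eqF.
  rewrite /calJr; have [->|nr] := eqVneq (n - r)%N 0%N.
    by rewrite !mul0r !subr0 !add0r mulr1.
  rewrite ln_div ?posrE ?ltr0n ?lt0n//; last by rewrite -lt0n.
  by field; rewrite gt_eqF.
have nrE : (n - r)%:R = n%:R - r%:R :> R by rewrite natrB.
move: Hn Hr; rewrite EJ E !ler_norml => /andP[h1 h2] /andP[h3 h4].
by rewrite nrE in h3 h4 *; apply/andP; split; lra.
Qed.

Lemma xlnx_ge (x : R) : 0 < x -> - (x * ln x) <= 2 * Num.sqrt x.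
Proof.
move=> x0; have s0 : 0 < Num.sqrt x by rewrite sqrtr_gt0.
have := ltW (ln_sublinear (x := (Num.sqrt x)^-1) _); rewrite invr_gt0 => /(_ s0).
rewrite lnV ?posrE// => h.
rewrite -[in X in - X](sqr_sqrtr (ltW x0)) lnXn// expr2.
have : Num.sqrt x * Num.sqrt x * (- ln (Num.sqrt x)) <= Num.sqrt x.
  rewrite -mulrA ger_pMr//.
  by rewrite -[leRHS](mulfV (x := Num.sqrt x)) ?gt_eqF// ler_wpM2l// ltW.
by rewrite mulr2n; lra.
Qed.

(** Modulus of continuity of [calJr] on [0, 1]. *)
Lemma calJr_modulus (u v d : R) : 0 <= v -> v <= u -> u <= 1 -> u - v <= d ->
  `|calJr v - calJr u| <= 2 * Num.sqrt d + d.
Proof.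
move=> v0; rewrite le_eqVlt => /predU1P[<-|vu] u1 uvd.
  rewrite subrr normr0; rewrite subrr in uvd.
  by rewrite addr_ge0// mulr_ge0// sqrtr_ge0.
have u0 : 0 < u by exact: le_lt_trans vu.
have d0 : 0 < u - v by rewrite subr_gt0.
have lnu : ln u <= 0 by exact: ln_le0.
have up : calJr u <= calJr v.
  rewrite /calJr; have [->|vn0] := eqVneq v 0.
    have : u * ln u <= 0 by rewrite mulr_ge0_le0// ltW.
    by rewrite mul0r; lra.
  have vp : 0 < v by rewrite lt_def vn0.
  (* v * ln (u / v) <= u - v *)
  have : v * (ln u - ln v) <= u - v.
    rewrite -ln_div ?posrE// (_ : u / v = 1 + (u - v) / v); last by field.
    have := @le_ln1Dx _ ((u - v) / v).
    rewrite (lt_trans (ltrN10 _)) ?divr_gt0// => /(_ isT) h.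
    by rewrite (le_trans (ler_wpM2l v0 h))// mulrC divfK.
  have : (u - v) * ln u <= 0 by rewrite mulr_ge0_le0// ltW.
  by lra.
have lo : calJr v - calJr u <= 2 * Num.sqrt (u - v) + (u - v).
  have h := xlnx_ge d0.
  suff : v * ln v - u * ln u <= - ((u - v) * ln (u - v)) by rewrite /calJr; lra.
  have l1 : ln (u - v) <= ln u by rewrite ler_ln ?posrE//; lra.
  have [->|vn0] := eqVneq v 0; first by rewrite mul0r subr0; lra.
  have vp : 0 < v by rewrite lt_def vn0.
  have l2 : ln v <= ln u by rewrite ler_ln ?posrE// ltW.
  have : v * ln v <= v * ln u by rewrite ler_wpM2l.
  have : (u - v) * ln (u - v) <= (u - v) * ln u by rewrite ler_wpM2l// ltW.
  by lra.
rewrite ger0_norm ?subr_ge0//; apply: (le_trans lo).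
by rewrite lerD// ler_wpM2l// ler_sqrt// (le_trans (ltW d0)).
Qed.

Lemma ln_le_sqrt (x : R) : 0 < x -> ln x <= 2 * Num.sqrt x.
Proof.
move=> x0; have s0 : 0 < Num.sqrt x by rewrite sqrtr_gt0.
rewrite -[in leLHS](sqr_sqrtr (ltW x0)) lnXn// mulr2n mulr_natl mulr2n.
by rewrite lerD// ltW// ln_sublinear.
Qed.

End asymptotics.

(** * Convergence of the log-determinant process *)

Section typical_consequences.
Context (R : realType) (a : nat * nat -> R) (n : nat).
Hypotheses (n2 : (2 < n)%N) (ta : typical n a).
Let L : R := ln n%:R.

Let n0 : 0 < n%:R :> R. Proof. by rewrite ltr0n; lia. Qed.
Let L0 : 0 <= L. Proof. by rewrite ln_ge0// ler1n; lia. Qed.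
Let lnX k : ln (n%:R ^+ k : R) = k%:R * L.
Proof. by rewrite lnXn// mulr_natl. Qed.

Let inve_lt (u c : R) : 0 <= u -> 0 < c -> ((u%:E)^-1 < c%:E)%E -> 0 < u /\ c^-1 < u.
Proof.
move=> u0 c0; rewrite inver; case: eqVneq => [->|un0]; first by rewrite ltNge leey.
have up : 0 < u by rewrite lt_def un0.
by rewrite lte_fin => h; split=> //; rewrite -[u]invrK ltf_pV2 ?posrE ?invr_gt0.
Qed.

Let gram_lower r : (r <= n - 2)%N ->
  0 < gram n r a /\ ln ((n ^_ r)%:R : R) - 6 * L <= ln (gram n r a).
Proof.
move=> rn; case: ta => _ /(_ r rn) H _ _ _.
have f0 : 0 < ((n - 2) ^_ r)%:R :> R by rewrite ltr0n ffact_gt0.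
have g0 : 0 < (n ^_ r)%:R :> R by rewrite ltr0n ffact_gt0; lia.
have c0 : 0 < n%:R ^+ 4 / ((n - 2) ^_ r)%:R :> R by rewrite divr_gt0 ?exprn_gt0.
have [gp glo] := inve_lt (gram_ge0 _ _ _) c0 H.
split=> //; apply: (@le_trans _ _ (ln (n%:R ^+ 4 / ((n - 2) ^_ r)%:R)^-1)); last first.
  by rewrite ler_ln ?posrE ?invr_gt0// ltW.
rewrite lnV ?posrE// ln_div ?posrE ?exprn_gt0// lnX.
have : ln ((n ^_ r)%:R : R) <= ln (n%:R ^+ 2 * ((n - 2) ^_ r)%:R).
  rewrite ler_ln ?posrE ?mulr_gt0 ?exprn_gt0// -natrX -natrM ler_nat.
  (* [n ^_ r.+2] is factored from both ends. *)
  have E : (n ^_ r * ((n - r) * (n - r).-1) = n * n.-1 * (n - 2) ^_ r)%N.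
    have -> : (n * n.-1 * (n - 2) ^_ r = n ^_ r.+2)%N.
      by rewrite !ffactnS mulnA subn2.
    by rewrite !ffactnSr -mulnA subnS.
  have : (1 <= (n - r) * (n - r).-1)%N by rewrite muln_gt0; lia.
  have : (n * n.-1 <= n ^ 2)%N by nia.
  by nia.
by rewrite lnM ?posrE ?exprn_gt0// lnX; lra.
Qed.

Let gram_last r : (n - 2 <= r < n)%N -> 0 < gram n r a ->
  0 < gram n r.+1 a /\ ln (gram n r a) - 4 * L <= ln (gram n r.+1 a).
Proof.
move=> rn g0; case: ta => _ _ /(_ r rn g0) H _ _.
have c0 : 0 < (n%:R ^+ 4)^-1 :> R by rewrite invr_gt0 exprn_gt0.
have h0 : 0 < (n%:R ^+ 4)^-1 * gram n r a by rewrite mulr_gt0.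
split; first exact: lt_trans H.
have : ln ((n%:R ^+ 4)^-1 * gram n r a) <= ln (gram n r.+1 a).
  by rewrite ler_ln ?posrE ?(lt_trans h0 H)// ltW.
by rewrite lnM ?posrE// lnV ?posrE ?exprn_gt0// lnX; lra.
Qed.

Let ffact_last r : (n - 2 <= r < n)%N ->
  ln ((n ^_ r.+1)%:R : R) <= ln (n ^_ r)%:R + L.
Proof.
move=> rn; have f0 : 0 < (n ^_ r)%:R :> R by rewrite ltr0n ffact_gt0; lia.
rewrite -lnM ?posrE// ler_ln ?posrE ?mulr_gt0//; last first.
  by rewrite ltr0n ffact_gt0; lia.
by rewrite ffactnSr natrM ler_wpM2l ?(ltW f0)// ler_nat leq_subr.
Qed.

Lemma typical_gram r : (r <= n)%N ->
  0 < gram n r a /\ `|ln (gram n r a) - ln (n ^_ r)%:R| <= 16 * L.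
Proof.
move=> rn; have f0 : 0 < (n ^_ r)%:R :> R by rewrite ltr0n ffact_gt0.
suff [g0 lo] : 0 < gram n r a /\ ln ((n ^_ r)%:R : R) - 16 * L <= ln (gram n r a).
  split=> //; case: ta => /(_ r rn)/ltW H _ _ _ _.
  have : ln (gram n r a) <= ln (n%:R ^+ 4 * (n ^_ r)%:R).
    by rewrite ler_ln ?posrE// mulr_gt0// exprn_gt0.
  rewrite lnM ?posrE ?exprn_gt0// lnX => h.
  by rewrite ler_norml; apply/andP; split; have := L0; lra.
have L0' := L0.
(* The loss is [6 * L] up to [n - 2]; each of the last two columns adds [4 * L]
for the Gram determinant and [L] for the falling factorial. *)
have [g2 lo2] := gram_lower (leqnn (n - 2)).
have r2 : (n - 2 <= n - 2 < n)%N by lia.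
have [g1 lo1] := gram_last r2 g2; have f1 := ffact_last r2.
have E1 : (n - 2).+1 = (n - 1)%N by lia.
rewrite E1 in g1 lo1 f1.
have r1 : (n - 2 <= n - 1 < n)%N by lia.
have [g0 lo0] := gram_last r1 g1; have f0' := ffact_last r1.
have E0 : (n - 1).+1 = n by lia.
rewrite E0 in g0 lo0 f0'.
have [rlt|rge] := leqP r (n - 2).
  by have [? ?] := gram_lower rlt; split=> //; lra.
have [->|rN] := eqVneq r n; first by split=> //; lra.
have -> : r = (n - 1)%N by lia.
by split=> //; lra.
Qed.

Lemma typical_sqnorms r : (r <= n)%N ->
  0 < sqnorms n r a /\ `|ln (sqnorms n r a) - r%:R * L| <= 4 * L + 6.
Proof.
move=> rn; case: ta => _ _ _ /(_ r rn)/ltW hi /(_ r rn) H.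
have m0 : 0 < (n - 2)%:R :> R by rewrite ltr0n; lia.
have c0 : 0 < n%:R ^+ 4 / (n - 2)%:R ^+ r :> R by rewrite divr_gt0 ?exprn_gt0.
have [s0 lo] := inve_lt (sqnorms_ge0 _ _ _) c0 H; split=> //.
have {}hi : ln (sqnorms n r a) <= ln (n%:R ^+ 4 * n%:R ^+ r).
  by rewrite ler_ln ?posrE// mulr_gt0 ?exprn_gt0.
have {}lo : ln (n%:R ^+ 4 / (n - 2)%:R ^+ r)^-1 <= ln (sqnorms n r a).
  by rewrite ler_ln ?posrE ?invr_gt0// ltW.
move: hi lo; rewrite lnM ?posrE ?exprn_gt0// lnV ?posrE//.
rewrite ln_div ?posrE ?exprn_gt0// !lnX lnXn// -[ln _ *+ r]mulr_natl => hi lo.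
(* r * ln (n / (n - 2)) <= n * 2 / (n - 2) <= 6 *)
have h : L - ln (n - 2)%:R <= 2 / (n - 2)%:R.
  rewrite -ln_div ?posrE// (_ : n%:R / (n - 2)%:R = 1 + 2 / (n - 2)%:R); last first.
    by rewrite natrB ?(ltnW n2)// in m0 *; field; rewrite gt_eqF.
  by apply: le_ln1Dx; rewrite (lt_trans (ltrN10 _)) ?divr_gt0.
have h' : r%:R * (L - ln (n - 2)%:R) <= 6.
  apply: (le_trans (ler_wpM2l (ler0n _ r) h)).
  rewrite mulrA ler_pdivrMr// -!natrM ler_nat; lia.
by rewrite ler_norml; apply/andP; split; have := L0; lra.
Qed.

End typical_consequences.

Lemma det_normalized_mx (R : realType) (b : nat -> nat -> R) n r :
  \det ((normalized_mx b n r)^T *m normalized_mx b n r) =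
  gram n r (fun ij => b ij.1 ij.2) / sqnorms n r (fun ij => b ij.1 ij.2).
Proof.
set a := fun ij => b ij.1 ij.2.
pose D := diag_mx (\row_(j < r) (Num.sqrt (sqnorm n j a))^-1).
have -> : normalized_mx b n r = array_mx n r a *m D.
  by apply/matrixP => i j; rewrite mul_mx_diag !mxE.
rewrite trmx_mul -mulmxA (mulmxA _ _ D) det_mulmx [\det (_ *m D)]det_mulmx det_tr.
rewrite mulrC -mulrA; congr (_ * _).
rewrite /D det_diag -expr2 -prodrXl /sqnorms -prodfV.
apply: eq_bigr => j _; rewrite mxE exprVn sqr_sqrtr//; exact: sqnorm_ge0.
Qed.

Lemma Upsilon_typical (R : realType) (b : nat -> nat -> R) n r :
  (2 < n)%N -> (r <= n)%N -> typical n (fun ij => b ij.1 ij.2) ->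
  exists2 y : R, Upsilon b n r = y%:E &
    `|y + n%:R * calJr (1 - r%:R / n%:R)| <= 22 * ln n%:R + 8.
Proof.
move=> n2 rn ta; have [g0 g1] := typical_gram n2 ta rn.
have [s0 s1] := typical_sqnorms n2 ta rn.
have f1 := @ln_ffact_approx R n r rn (ltnW (ltnW n2)).
rewrite /Upsilon det_normalized_mx lne_EFin ?divr_gt0//; eexists; first by [].
rewrite ln_div ?posrE//; move: g1 s1 f1; rewrite !ler_norml.
move=> /andP[? ?] /andP[? ?] /andP[? ?]; apply/andP; split; lra.
Qed.

Lemma Upsilon_proc_typical (R : realType) (b : nat -> nat -> R) n (t : R) :
  (2 < n)%N -> typical n (fun ij => b ij.1 ij.2) -> 0 <= t <= 1 ->
  (`|Upsilon_proc b n t / n%:R%:E + calJ (1 - t)| <= (55 / Num.sqrt n%:R)%:E)%E.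
Proof.
move=> n2 ta /andP[t0 t1].
have n0 : 0 < n%:R :> R by rewrite ltr0n; lia.
have nt0 : 0 <= n%:R * t by rewrite mulr_ge0// ltW.
rewrite /Upsilon_proc; set r := Num.truncn (n%:R * t).
have /andP[r1 r2] : r%:R <= n%:R * t < r.+1%:R by exact: truncn_itv.
have rn : (r <= n)%N by rewrite -(ler_nat R) (le_trans r1)// ger_pMr.
have [y -> hy] := Upsilon_typical n2 rn ta.
rewrite calJE ?subr_ge0// inver gt_eqF// -EFinM -EFinD abse_EFin lee_fin.
set s := Num.sqrt n%:R; have s0 : 0 < s by rewrite sqrtr_gt0.
have ss : s * s = n%:R by rewrite -expr2 sqr_sqrtr// ltW.
have s1 : 1 <= s by rewrite -sqrtr1 ler_sqrt// ler1n; lia.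
have L2 : ln n%:R <= 2 * s by exact: ln_le_sqrt.
have hJ : `|calJr (1 - t) - calJr (1 - r%:R / n%:R)| <= 2 / s + s^-1.
  have e0 : r%:R / n%:R <= t by rewrite ler_pdivrMr// mulrC.
  have e1 : t - r%:R / n%:R <= n%:R^-1.
    by rewrite lerBlDr -[X in X + _]mul1r -mulrDl ler_pdivlMr// mulrC addrC natr1 ltW.
  apply: (le_trans (@calJr_modulus _ (1 - r%:R / n%:R) (1 - t) n%:R^-1 _ _ _ _)).
  - by rewrite subr_ge0.
  - by rewrite lerD2l lerN2.
  - by rewrite gerBl divr_ge0// ltW.
  - by lra.
  - rewrite sqrtrV ?(ltW n0)// -/s lerD2l lef_pV2 ?posrE// -ss.
    by rewrite -[leLHS]mul1r ler_wpM2r// ltW.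
have -> : y / n%:R + calJr (1 - t) = (y + n%:R * calJr (1 - r%:R / n%:R)) / n%:R +
    (calJr (1 - t) - calJr (1 - r%:R / n%:R)) by field; rewrite gt_eqF.
apply: (le_trans (ler_normD _ _)).
have h1 : `|(y + n%:R * calJr (1 - r%:R / n%:R)) / n%:R| <= 52 / s.
  rewrite normrM [X in _ * X]ger0_norm ?invr_ge0 ?(ltW n0)//.
  have sE : 52 / s * n%:R = 52 * s by rewrite -ss; field; rewrite gt_eqF.
  rewrite ler_pdivrMr// sE; apply: (le_trans hy).
  by lra.
apply: (le_trans (lerD h1 hJ)).
by rewrite le_eqVlt; apply/orP; left; apply/eqP; field; rewrite gt_eqF.
Qed.

Theorem theorem4p2 (d : measure_display) (T : measurableType d) (R : realType)
    (P : probability T R) (b : nat -> nat -> {RV P >-> R})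
    (hb : iid_standard_normal (fun ij : nat * nat => b ij.1 ij.2)) :
  {ae P, forall w : T,
    (fun n : nat =>
      ereal_sup [set `|Upsilon_proc (fun i j => b i j w) n t / n%:R%:E
                       + calJ (1 - t)|%E
                | t in `[0, 1]%classic]) @ \oo --> 0%E}.
Proof.
have := ae_eventually_typical hb; apply: filterS => w tw.
apply: (@squeeze_cvge _ _ _ _ (cst 0%E) _ (fun n => (55 / Num.sqrt n%:R)%:E)).
- near=> n; apply/andP; split.
    apply: (@le_trans _ _ `|Upsilon_proc (fun i j => b i j w) n 0 / n%:R%:E
                       + calJ (1 - 0)|%E); first exact: abse_ge0.
    by apply: ereal_sup_ubound; exists 0 => //=; rewrite in_itv/= lexx ler01.
  apply: ub_ereal_sup => _ [t /= t01 <-].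
  apply: Upsilon_proc_typical; first by near: n; exact: nbhs_infty_gt.
    by near: n.
  by move: t01; rewrite in_itv.
- exact: cvg_cst.
- apply: cvg_EFin; first exact: nearW.
  apply/cvgrPdist_lt => e e0; near=> n.
  have n0 : 0 < n%:R :> R by rewrite ltr0n; near: n; exact: nbhs_infty_gt.
  rewrite sub0r normrN ger0_norm ?divr_ge0 ?sqrtr_ge0//.
  rewrite ltr_pdivrMr ?sqrtr_gt0// mulrC -ltr_pdivrMr//.
  rewrite -[ltLHS]ger0_norm ?divr_ge0 ?(ltW e0)// -sqrtr_sqr ltr_sqrt//.
  by near: n; exact: nbhs_infty_gtr.
Unshelve. all: by end_near. Qed.
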